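(* Let $\lambda>0$ and $\alpha\in(0,2)$. For $\gamma>0$ let $$A(t)=A_\gamma(t)=\sum_{j=0}^{N(t)}\epsilon_j\,\gamma\,e^{X_j},\qquad t>0,$$ where $N(t)$, $t>0$, is a Poisson process with rate $\lambda$, the $X_j$ ($j=0,1,2,\dots$) are exponential random variables with parameter $\alpha$ (density $\alpha e^{-\alpha x}$, $x>0$), the $\epsilon_j$ satisfy $P\{\epsilon_j=+1\}=P\{\epsilon_j=-1\}=1/2$, and $N$, $(X_j)_{j\ge0}$, $(\epsilon_j)_{j\ge0}$ are all mutually independent. Let $\mathfrak{S}^{\alpha}(t)$ be the symmetric $\alpha$-stable process on $\mathbb{R}$, with $\mathbb{E}e^{i\xi\mathfrak{S}^\alpha(t)}=e^{-t|\xi|^\alpha}$, $\xi\in\mathbb{R}$. Put $$C=\frac12\int_{\mathbb{R}}\frac{1-\cos y}{|y|^{\alpha+1}}\,dy,\qquad t^*=\alpha\lambda C\,t.$$ Then, for every $t>0$, $$A_\gamma(t/\gamma^\alpha)\ \longrightarrow\ \mathfrak{S}^\alpha(t^* )\qquad\text{in distribution as }\gamma\to0,$$ and the limit process $t\mapsto\mathfrak{S}^\alpha(t^* )$ has generator $$\mathcal{A}f(x)=-\alpha\lambda C\,\frac{d^\alpha f}{d|x|^\alpha}(x),\qquad f\in\mathscr{S}(\mathbb{R}),$$ where $\frac{d^\alpha}{d|x|^\alpha}$ is the Riesz operator.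
   Context: Fourier transform: $\widehat f(\xi)=\int_{\mathbb{R}}e^{i\xi x}f(x)\,dx$. The Riesz operator $\frac{d^\alpha}{d|x|^\alpha}$, $\alpha\in(0,2)$, is the operator with Fourier multiplier $|\xi|^\alpha$: $$\int_{\mathbb{R}}e^{i\xi x}\frac{d^\alpha f}{d|x|^\alpha}(x)\,dx=|\xi|^\alpha\,\widehat f(\xi).$$ Generator convention: for a Lévy process $F_t$ on $\mathbb{R}$ started at $0$, its Fourier symbol is $\Phi(\xi)=-\partial_t\,\mathbb{E}e^{i\xi F_t}\big|_{t=0}$ (so $\mathbb{E}e^{i\xi F_t}=e^{-t\Phi(\xi)}$), and its generator $\mathcal{A}$ is the operator $$(\mathcal{A}f)(x)=-\frac{1}{2\pi}\int_{\mathbb{R}}e^{-i\xi x}\,\Phi(\xi)\,\widehat f(\xi)\,d\xi,$$ i.e. $\widehat{\mathcal{A}f}(\xi)=-\Phi(\xi)\widehat f(\xi)$. $\mathscr{S}(\mathbb{R})$ is the space of rapidly decaying $C^\infty$ functions. *)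

(* Defs.v *)
(* MathComp-Analysis; complex numbers are R[i] from mathcomp-real-closed. *)
From HB Require Import structures.
From mathcomp Require Import all_boot all_order all_algebra.
From mathcomp Require Import all_classical all_reals all_analysis.
From mathcomp Require Import complex.

Set Implicit Arguments.
Unset Strict Implicit.
Unset Printing Implicit Defensive.

Import Order.TTheory GRing.Theory Num.Theory.
Import numFieldNormedType.Exports.

Local Open Scope classical_set_scope.
Local Open Scope ring_scope.

(** * Independence *)

Definition sigma_of d d' (T : measurableType d) (T' : measurableType d')
    (X : T -> T') : set (set T) :=
  preimage_set_system [set: T] X (@measurable d' T').

Definition mutually_independent d (T : measurableType d) (R : realType)
    (P : probability T R) (I : eqType) (G : I -> set (set T)) : Prop :=
  forall (J : seq I) (E : I -> set T), uniq J ->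
    (forall j, j \in J -> G j (E j)) ->
    P (\big[setI/[set: T]]_(j <- J) E j) = (\prod_(j <- J) P (E j))%E.

(** * Processes

    The time set is [0, +oo[; a process is indexed by R, and its values at
    negative times are never used. *)

(* Finite increasing families of times are initial segments of sequences. *)
Definition independent_increments d (T : measurableType d) (R : realType)
    (P : probability T R) (F : R -> T -> R) : Prop :=
  forall tau : nat -> R, 0 <= tau 0 -> nondecreasing_seq tau ->
    mutually_independent P
      (fun i : nat => sigma_of (fun w => F (tau i.+1) w - F (tau i) w)).

(* No path regularity is required: stochastic continuity is the usual
   substitute, and yields a cadlag modification. *)
Definition levy_process d (T : measurableType d) (R : realType)
    (P : probability T R) (F : R -> {RV P >-> R}) : Prop :=
  [/\ \forall w \ae P, F 0 w = 0,
      independent_increments P (fun t => F t : T -> R),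
      forall (s t : R) (B : set R), 0 <= s -> 0 <= t -> measurable B ->
        P [set w | B (F (s + t) w - F s w)] = P [set w | B (F t w)] &
      forall t e : R, 0 <= t -> 0 < e ->
        P [set w | e < `|F s w - F t w|]
          @[s --> within [set s | 0 <= s] (nbhs t)] --> (0 : \bar R)%E].

(* The law of the increments is given without a subtraction, since subtraction
   of natural numbers is truncated. *)
Definition poisson_process d (T : measurableType d) (R : realType)
    (P : probability T R) (rate : R) (N : R -> {RV P >-> nat}) : Prop :=
  [/\ \forall w \ae P, N 0 w = 0%N,
      \forall w \ae P, forall s t : R, 0 <= s -> s <= t -> (N s w <= N t w)%N,
      \forall w \ae P, forall t : R, 0 <= t ->
        \forall s \near t^'+, N s w = N t w,
      independent_increments P (fun t w => (N t w)%:R : R) &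
      forall (s t : R) (k : nat), 0 <= s -> s < t ->
        P [set w | N t w = (N s w + k)%N] =
          (poisson_pmf (rate * (t - s)) k)%:E].

(* Convergence in law along the filter F, tested on bounded continuous
   functions; the limit may live on another probability space. *)
Definition cvg_in_distribution d d' (T : measurableType d)
    (T' : measurableType d') (R : realType) (P : probability T R)
    (Q : probability T' R) (I : Type) (F : set_system I) (X : I -> T -> R)
    (Y : T' -> R) : Prop :=
  forall g : R -> R, continuous g -> (exists M : R, forall x, `|g x| <= M) ->
    ('E_P[fun w => g (X i w)] @[i --> F] --> 'E_Q[fun w => g (Y w)])%E.

(** * Complex-valued integration and Fourier transform *)

Definition cintegrable d (T : measurableType d) (R : realType)
    (mu : {measure set T -> \bar R}) (f : T -> R[i]) : Prop :=
  mu.-integrable [set: T] (fun x => (complex.Re (f x))%:E) /\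
  mu.-integrable [set: T] (fun x => (complex.Im (f x))%:E).

Definition cintegral d (T : measurableType d) (R : realType)
    (mu : {measure set T -> \bar R}) (f : T -> R[i]) : R[i] :=
  ((\int[mu]_x complex.Re (f x)) +i* (\int[mu]_x complex.Im (f x)))%C.

Definition cis (R : realType) (x : R) : R[i] := (cos x +i* sin x)%C.

Definition fourier (R : realType) (f : R -> R[i]) (xi : R) : R[i] :=
  cintegral lebesgue_measure (fun x : R => cis (xi * x) * f x).

Definition char_fun d (T : measurableType d) (R : realType)
    (P : probability T R) (X : T -> R) (xi : R) : R[i] :=
  cintegral P (fun w => cis (xi * X w)).

Definition real_schwartz (R : realType) (f : R -> R) : Prop :=
  (forall (n : nat) (x : R), derivable (derive1n n f) x 1) /\
  (forall m n : nat, exists M : R, forall x, `|x| ^+ m * `|derive1n n f x| <= M).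

Definition schwartz (R : realType) (f : R -> R[i]) : Prop :=
  real_schwartz (fun x => complex.Re (f x)) /\
  real_schwartz (fun x => complex.Im (f x)).

(** * Stable processes, generators and the Riesz operator *)

Definition symmetric_stable_process d (T : measurableType d) (R : realType)
    (P : probability T R) (alpha : R) (S : R -> {RV P >-> R}) : Prop :=
  levy_process S /\
  forall t xi : R, 0 <= t ->
    char_fun P (S t) xi = ((expR (- t * `|xi| `^ alpha))%:C)%C.

(* Phi(xi) = - d/dt E exp(i xi F_t) at t = 0; the time set being [0, +oo[, this
   is a right derivative. *)
Definition fourier_symbol d (T : measurableType d) (R : realType)
    (P : probability T R) (F : R -> {RV P >-> R}) (Phi : R -> R[i]) : Prop :=
  forall xi : R,
    let D (t : R) : R[i] := char_fun P (F t) xi - char_fun P (F 0) xi in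
    t^-1 * complex.Re (D t) @[t --> 0^'+] --> - complex.Re (Phi xi) /\
    t^-1 * complex.Im (D t) @[t --> 0^'+] --> - complex.Im (Phi xi).

Definition has_generator d (T : measurableType d) (R : realType)
    (P : probability T R) (F : R -> {RV P >-> R})
    (A : (R -> R[i]) -> R -> R[i]) : Prop :=
  levy_process F /\
  exists2 Phi : R -> R[i], fourier_symbol F Phi &
    forall f : R -> R[i], schwartz f -> forall x : R,
      let h (xi : R) : R[i] := cis (- (xi * x)) * Phi xi * fourier f xi in
      cintegrable lebesgue_measure h /\
      A f x = - (((2 * pi)^-1)%:C)%C * cintegral lebesgue_measure h.

(* The Fourier transform determines D f only almost everywhere: continuity
   selects the representative, so D is unique on Schwartz functions. *)
Definition riesz_operator (R : realType) (alpha : R)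
    (D : (R -> R[i]) -> R -> R[i]) : Prop :=
  forall f : R -> R[i], schwartz f ->
    [/\ continuous (fun x => complex.Re (D f x)),
        continuous (fun x => complex.Im (D f x)),
        cintegrable lebesgue_measure (D f) &
        forall xi : R,
          fourier (D f) xi = ((`|xi| `^ alpha)%:C)%C * fourier f xi].

(** * The jump process *)

(* One sigma-algebra for the whole process N, and one for each of the X_j and
   of the eps_j. *)
Definition input_sigma d (T : measurableType d) (R : realType)
    (P : probability T R) (N : R -> {RV P >-> nat})
    (X eps : nat -> {RV P >-> R}) (i : unit + (nat + nat)) : set (set T) :=
  match i with
  | inl _ => <<s \bigcup_(t in [set t : R | 0 <= t]) sigma_of (N t) >>
  | inr (inl j) => sigma_of (X j)
  | inr (inr j) => sigma_of (eps j)
  end.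

Definition jump_sum d (T : measurableType d) (R : realType)
    (P : probability T R) (N : R -> {RV P >-> nat})
    (X eps : nat -> {RV P >-> R}) (gamma t : R) (w : T) : R :=
  \sum_(0 <= j < (N t w).+1) eps j w * gamma * expR (X j w).

Definition stable_const (R : realType) (alpha : R) : R :=
  2^-1 * \int[lebesgue_measure]_(y in [set: R])
           ((1 - cos y) / (`|y| `^ (alpha + 1))).

(* Main.v *)
Require Import Defs.
From HB Require Import structures.
From mathcomp Require Import all_boot all_order all_algebra.
From mathcomp Require Import all_classical all_reals all_analysis.
From mathcomp Require Import measurable_realfun.
From mathcomp Require Import complex ring lra.

Set Implicit Arguments.
Unset Strict Implicit.
Unset Printing Implicit Defensive.

Import Order.TTheory GRing.Theory Num.Theory.
Import numFieldNormedType.Exports.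

Local Open Scope classical_set_scope.
Local Open Scope ring_scope.

(** Convergence in distribution.  Given N(t) = n, the sum has n + 1 terms, so by
    independence, and because the signs are symmetric, its characteristic
    function is psi ^ (n + 1) with psi(u) = E cos (u e^X) taken at u = xi gamma;
    summing over the Poisson law gives psi exp (- lambda t (1 - psi))
    ([jump_sum_chi]).  The exponential X turns 1 - psi(u) into
    alpha |u|^alpha times the integral of (1 - cos y) / y^(alpha + 1) over
    y >= |u| ([jump_psi_compl]); with t replaced by t / gamma^alpha the powers
    of gamma cancel and, as gamma decreases to 0, the truncated integral tends
    to the stable constant C ([jump_exponent_cvg]).  Levy's continuity theorem
    ([levy_continuity]) turns convergence of the characteristic functions into
    convergence in distribution.

    Generator.  The symbol of the time-changed stable process is
    alpha lambda C |xi|^alpha, so the claim is that the multiplier |xi|^alpha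
    is carried by an operator D with integrable continuous values.  Such a D is
    the singular integral
      D f (x) = (2 C)^-1 times the integral over y > 0 of
                (2 f (x) - f (x + y) - f (x - y)) / y^(alpha + 1).
    By Fubini and a translation its Fourier transform is that of f times
    (2 C)^-1 times the integral of (2 - 2 cos (xi y)) / y^(alpha + 1), which is
    |xi|^alpha by scaling ([trig_transform_riesz]); Fourier inversion
    ([fourier_inversion]) then yields the formula required of the generator
    ([riesz_inversion]).

    Two devices keep the analysis elementary.  All singular integrals over
    y > 0 are written with y = e^s: dilations become translations, and the
    weight dy / y^(alpha + 1) becomes e^(- alpha s) ds, which against a second
    difference is dominated by an exponential in |s|.  Levy's theorem and
    Fourier inversion both come from smoothing by the Poisson kernel
    2 a / (a^2 + z^2), whose transform e^(- a |xi|) needs only an explicit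
    primitive. *)

(** * Integrals of real functions *)

Definition L1 d (T : measurableType d) (R : realType)
    (mu : {measure set T -> \bar R}) (f : T -> R) : Prop :=
  mu.-integrable [set: T] (EFin \o f).

Section real_integrals.
Context d (T : measurableType d) (R : realType).
Variable mu : {measure set T -> \bar R}.
Implicit Types (f g h : T -> R).

Lemma L1_measurable f : L1 mu f -> measurable_fun setT f.
Proof. by move=> /measurable_int /measurable_EFinP. Qed.

Lemma L1_dominated g f : measurable_fun setT f -> (forall x, `|f x| <= g x) ->
  L1 mu g -> L1 mu f.
Proof.
move=> mf fg; apply: le_integrable => //; first exact/measurable_EFinP.
by move=> x _ /=; rewrite lee_fin (le_trans (fg x))// ler_norm.
Qed.

Lemma L1D f g : L1 mu f -> L1 mu g -> L1 mu (fun x => f x + g x).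
Proof. by move=> lf lg; exact: (integrableD measurableT lf lg). Qed.

Lemma L1B f g : L1 mu f -> L1 mu g -> L1 mu (fun x => f x - g x).
Proof. by move=> lf lg; exact: (integrableB measurableT lf lg). Qed.

Lemma L1Z k f : L1 mu f -> L1 mu (fun x => k * f x).
Proof. by move=> lf; exact: (integrableZl measurableT k lf). Qed.

Lemma L1_norm f : L1 mu f -> L1 mu (fun x => `|f x|).
Proof. by move=> lf; exact: (integrable_norm lf). Qed.

Lemma L1_mul_bounded M f g : measurable_fun setT g ->
  (forall x, `|g x| <= M) -> L1 mu f -> L1 mu (fun x => g x * f x).
Proof.
move=> mg gM lf; apply: (@L1_dominated (fun x => M * `|f x|)).
- by apply: measurable_funM => //; exact: L1_measurable.
- by move=> x; rewrite normrM ler_wpM2r.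
- exact/L1Z/L1_norm.
Qed.

Lemma EFin_Rintegral f : L1 mu f ->
  (\int[mu]_x (f x)%:E)%E = (\int[mu]_x f x)%:E.
Proof. by move=> lf; rewrite /Rintegral fineK// integrable_fin_num. Qed.

Lemma RintegralDT f g : L1 mu f -> L1 mu g ->
  \int[mu]_x (f x + g x) = \int[mu]_x f x + \int[mu]_x g x.
Proof. by move=> lf lg; rewrite RintegralD. Qed.

Lemma RintegralBT f g : L1 mu f -> L1 mu g ->
  \int[mu]_x (f x - g x) = \int[mu]_x f x - \int[mu]_x g x.
Proof. by move=> lf lg; rewrite RintegralB. Qed.

Lemma RintegralZT k f : L1 mu f ->
  \int[mu]_x (k * f x) = k * \int[mu]_x f x.
Proof. by move=> lf; rewrite RintegralZl. Qed.

Lemma RintegralNT f : L1 mu f -> \int[mu]_x (- f x) = - \int[mu]_x f x.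
Proof.
move=> lf; under eq_Rintegral do rewrite -mulN1r.
by rewrite RintegralZT// mulN1r.
Qed.

Lemma le_RintegralT f g : L1 mu f -> L1 mu g -> (forall x, f x <= g x) ->
  \int[mu]_x f x <= \int[mu]_x g x.
Proof. by move=> lf lg fg; apply: le_Rintegral. Qed.

Lemma norm_Rintegral_le f g : L1 mu f -> L1 mu g -> (forall x, `|f x| <= g x) ->
  `|\int[mu]_x f x| <= \int[mu]_x g x.
Proof.
move=> lf lg fg; apply: (le_trans (le_normr_Rintegral _ lf)) => //.
by apply: le_RintegralT => //; exact: L1_norm.
Qed.

Lemma ae_eq_Rintegral f g : measurable_fun setT f -> measurable_fun setT g ->
  {ae mu, forall x, f x = g x} -> \int[mu]_x f x = \int[mu]_x g x.
Proof.
move=> mf mg fg; congr fine; apply: ae_eq_integral => //; try exact/measurable_EFinP.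
by apply: filterS fg => x /= -> _.
Qed.

(** The bound passes to the limit [f], so that only the measurability of [f] is
    asked. *)
Lemma Rintegral_cvg_dominated (f_ : nat -> T -> R) f g :
  (forall n, measurable_fun setT (f_ n)) -> measurable_fun setT f ->
  (forall x, f_ n x @[n --> \oo] --> f x) ->
  (forall n x, `|f_ n x| <= g x) -> L1 mu g ->
  \int[mu]_x f_ n x @[n --> \oo] --> \int[mu]_x f x.
Proof.
move=> mf_ mf cf fg lg.
have lf_ n : L1 mu (f_ n) by exact: L1_dominated (fg n) lg.
have lf : L1 mu f.
  apply: (@L1_dominated g) => // x.
  rewrite (_ : `|f x| = limn (fun n => `|f_ n x|)); last first.
    by apply/esym/cvg_lim => //; apply: cvg_norm.
  apply: limr_le; first by apply/cvg_ex; exists `|f x|; apply: cvg_norm.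
  by near=> n.
have [] := @dominated_convergence _ T R mu setT measurableT
  (fun n => EFin \o f_ n) (EFin \o f) (EFin \o g).
- by move=> n; apply/measurable_EFinP.
- exact/measurable_EFinP.
- by apply: aeW => x _; apply: cvg_EFin; [near=> n | exact: cf].
- exact: lg.
- by apply: aeW => x n _; rewrite lee_fin.
move=> _ _ h; apply: fine_cvg.
by rewrite -(EFin_Rintegral lf).
Unshelve. all: by end_near. Qed.

End real_integrals.

Section real_fubini.
Context d1 d2 (T1 : measurableType d1) (T2 : measurableType d2) (R : realType).
Variables (m1 : {sigma_finite_measure set T1 -> \bar R}).
Variables (m2 : {sigma_finite_measure set T2 -> \bar R}).

(** Absolute integrability is checked in the order that integrates over the
    first variable first, where the bound [B] is available; integrability of
    every section keeps both inner integrals real-valued. *)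
Lemma Rintegral_swap (f : T1 -> T2 -> R) (B : T2 -> R) :
  measurable_fun setT (fun z : T1 * T2 => f z.1 z.2) ->
  (forall x, L1 m2 (f x)) -> (forall y, L1 m1 (f ^~ y)) ->
  (forall y, \int[m1]_x `|f x y| <= B y) -> L1 m2 B ->
  [/\ L1 m1 (fun x => \int[m2]_y f x y), L1 m2 (fun y => \int[m1]_x f x y) &
  \int[m1]_x \int[m2]_y f x y = \int[m2]_y \int[m1]_x f x y].
Proof.
move=> mf f2 f1 fB lB.
have mF : measurable_fun setT (fun z : T1 * T2 => (f z.1 z.2)%:E).
  exact/measurable_EFinP.
have intf : (m1 \x m2)%E.-integrable setT (fun z => (f z.1 z.2)%:E).
  apply/integrable21ltyP => //=.
  apply: (@le_lt_trans _ _ (\int[m2]_y (B y)%:E)%E); last first.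
    by rewrite EFin_Rintegral// ltry.
  apply: ge0_le_integral => //=.
  - by move=> y _; exact: integral_ge0.
  - apply: (measurable_fun_fubini_tonelli_G
      (abse \o (fun z : T1 * T2 => (f z.1 z.2)%:E))) => //=.
    exact: measurableT_comp.
  - exact/measurable_EFinP/(L1_measurable lB).
  - move=> y _; rewrite (EFin_Rintegral (L1_norm (f1 y))) lee_fin; exact: fB.
have E1 x : (\int[m2]_y (f x y)%:E = (\int[m2]_y f x y)%:E)%E.
  exact: EFin_Rintegral.
have E2 y : (\int[m1]_x (f x y)%:E = (\int[m1]_x f x y)%:E)%E.
  exact: EFin_Rintegral.
split.
  have := integrable_fubini_F intf.
  apply: eq_integrable => // x _; exact: E1.
  apply: (@L1_dominated _ _ _ m2 B) => //; last first.
    move=> y; apply: le_trans (fB y).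
    exact: norm_Rintegral_le (f1 y) (L1_norm (f1 y)) _.
  apply/measurable_EFinP; have := measurable_fubini_G intf.
  by apply: eq_measurable_fun => y _; rewrite /fubini_G/= E2.
congr fine.
under eq_integral do rewrite -E1.
under [RHS]eq_integral do rewrite -E2.
exact: (Fubini intf).
Qed.

End real_fubini.

(** * Changes of variable for Lebesgue measure *)

Section lebesgue_invariance.
Context (R : realType).
Notation mu := (@lebesgue_measure R).
Implicit Types (f : R -> R).

Let measure_preserving (phi : R -> R) f :
  measurable_fun [set: R] phi ->
  (forall A : set R, measurable A -> mu (phi @^-1` A) = mu A) ->
  L1 mu f -> L1 mu (f \o phi) /\ \int[mu]_x f (phi x) = \int[mu]_x f x.
Proof.
move=> mphi E lf.
pose mphi' : measurable_fun [set: measurableTypeR R]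
  (phi : measurableTypeR R -> measurableTypeR R) := mphi.
have EI (g : R -> \bar R) : 
    (\int[pushforward mu (phi : measurableTypeR R -> measurableTypeR R)]_x g x
     = \int[mu]_x g x)%E.
  apply: (@eq_measure_integral _ _ _ setT mu
   (measure_function_pushforward__canonical__measure_function_Measure mu mphi')).
  by move=> A mA _; exact: E.
have mf := L1_measurable lf.
have lp : L1 mu (f \o phi).
  apply/integrableP; split.
    by apply/measurable_EFinP; apply: measurableT_comp.
  have := @ge0_integral_pushforward _ _ (measurableTypeR R) (measurableTypeR R) _ phi mphi' mu setT
    (fun x => `|(f x)%:E|%E) measurableT.
  rewrite EI preimage_setT => <-//=.
  - by case/integrableP: lf.
  - exact/measurable_EFinP/measurableT_comp.
split => //; congr fine.
have := @integral_pushforward _ _ (measurableTypeR R) (measurableTypeR R) _ phi mphi' mu setT (EFin \o f).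
rewrite EI preimage_setT => ->//.
exact/measurable_EFinP.
Qed.

Lemma L1_shift c f : L1 mu f -> L1 mu (fun x => f (x + c)) /\
  \int[mu]_x f (x + c) = \int[mu]_x f x.
Proof.
apply: (@measure_preserving (+%R^~ c) f).
  apply: continuous_measurable_fun => x; apply: cvgD => //; exact: cvg_cst.
have mphi : measurable_fun [set: measurableTypeR R]
    ((+%R^~ c) : measurableTypeR R -> measurableTypeR R).
  by apply: continuous_measurable_fun => x; apply: cvgD => //; exact: cvg_cst.
move=> A mA.
apply/esym/(@lebesgue_measure_unique R
  (measure_function_pushforward__canonical__measure_function_Measure mu mphi))
  => // _ [[a b]] _ <- /=.
rewrite /pushforward (_ : _ @^-1` _ = `](a - c), (b - c)]%classic); last first.
  by apply/seteqP; split => x /=; rewrite !in_itv/= ltrBlDr lerBrDr.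
rewrite !lebesgue_measure_itv/= !lte_fin ltrD2r; case: ifP => // _.
by rewrite -!EFinD; congr EFin; ring.
Qed.

Lemma L1_opp f : L1 mu f -> L1 mu (fun x => f (- x)) /\
  \int[mu]_x f (- x) = \int[mu]_x f x.
Proof.
apply: (@measure_preserving -%R f).
  apply: continuous_measurable_fun => x; exact: cvgN.
by move=> A mA; exact: lebesgue_measureN.
Qed.

Lemma ge0_integral_affine (G : R -> R) (x e : R) : 0 < e -> continuous G ->
  (forall y, 0 <= G y) ->
  (\int[mu]_y (G y)%:E = \int[mu]_u (e * G (x + e * u))%:E)%E.
Proof.
move=> e0 cG G0; pose F (u : R) : R := x + e * u.
have dF (u : R) : is_derive u 1 F e.
  have := is_deriveD (is_derive_cst x u 1) (is_deriveZ e (is_derive_id u (1 : R))).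
  by rewrite add0r [_ *: 1]mulr1; exact.
have F' : F^`()%classic = cst e by apply/funext => u; rewrite derive1E derive_val.
rewrite (@increasing_ge0_integration_by_substitutionT _ F G)//.
- by apply: eq_integral => u _; rewrite F' /= mulrC.
- by move=> u v uv; rewrite ltrD2l ltr_pM2l.
- by rewrite F' => u; exact: cvg_cst.
- by rewrite F'; exact: is_cvg_cst.
- by rewrite F'; exact: is_cvg_cst.
- apply/cvgrNyPle => A; near=> u.
  have -> : A = x + e * ((A - x) / e).
    by rewrite mulrC divfK ?gt_eqF// addrC subrK.
  rewrite lerD2l ler_pM2l//; near: u; apply: nbhs_ninfty_le; exact: num_real.
- apply/cvgryPge => A; near=> u.
  have -> : A = x + e * ((A - x) / e).
    by rewrite mulrC divfK ?gt_eqF// addrC subrK.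
  rewrite lerD2l ler_pM2l//; near: u; apply: nbhs_pinfty_ge; exact: num_real.
Unshelve. all: by end_near. Qed.

End lebesgue_invariance.

(** * The Cauchy density and the transform of e^(- a |s|) *)

Section kernels.
Context (R : realType).
Notation mu := (@lebesgue_measure R).

Lemma ge0_L1_integral (f : R -> R) (I : R) : measurable_fun setT f ->
  (forall x, 0 <= f x) -> (\int[mu]_x (f x)%:E = I%:E)%E ->
  L1 mu f /\ \int[mu]_x f x = I.
Proof.
move=> mf f0 E; split; last by rewrite /Rintegral E.
apply/integrableP; split; first exact/measurable_EFinP.
under eq_integral do rewrite /= ger0_norm//.
by rewrite E ltry.
Qed.

Lemma integral_cauchy_kernel :
  L1 mu (fun u => (1 + u ^+ 2)^-1) /\ \int[mu]_u (1 + u ^+ 2)^-1 = pi.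
Proof.
have c := @continuous_oneDsqrV R.
apply: ge0_L1_integral.
- exact: continuous_measurable_fun.
- by move=> x; rewrite invr_ge0 addr_ge0// sqr_ge0.
rewrite (@ge0_symfun_integralT _ (fun u => (1 + u ^+ 2)^-1))//.
- rewrite -set_itvcy [X in (_ * X)%E](@integral0y_oneDsqr R) -EFinM.
  by congr EFin; rewrite mulrC divfK.
- by move=> x; rewrite invr_ge0 addr_ge0// sqr_ge0.
- by move=> x; rewrite /= sqrrN.
Qed.

(** A primitive of e^(- a s) (1 + cos (z s)): the fundamental theorem on a
    half-line asks for a nonnegative integrand, which adding 1 to the cosine
    provides. *)
Let F (a z s : R) : R := expR (- a * s) *
  (- a^-1 + (z * sin (z * s) - a * cos (z * s)) / (a ^+ 2 + z ^+ 2)).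

Let dF (a z s : R) : 0 < a ->
  is_derive s 1 (F a z) (expR (- a * s) * (1 + cos (z * s))).
Proof.
move=> a0; rewrite /F; apply: is_derive_eq; rewrite /GRing.scale/=.
have D0 : a ^+ 2 + z ^+ 2 != 0 by rewrite gt_eqF// ltr_pwDl ?exprn_gt0// sqr_ge0.
by field; rewrite D0 gt_eqF.
Qed.

Lemma cvg_expRN (a : R) : 0 < a -> expR (- a * s) @[s --> +oo] --> 0.
Proof.
move=> a0; rewrite (_ : (fun s => _) = (fun s => expR (- s)) \o (fun s => a * s)).
  by apply: (cvg_comp _ _ _ (@cvgr_expR R)); exact: gt0_cvgMry.
by apply/funext => s /=; rewrite mulNr.
Qed.

Let cvgF (a z : R) : 0 < a -> F a z s @[s --> +oo] --> 0.
Proof.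
move=> a0; pose M := a^-1 + (`|z| + a) / (a ^+ 2 + z ^+ 2).
have D0 : 0 < a ^+ 2 + z ^+ 2 by rewrite ltr_pwDl ?exprn_gt0// sqr_ge0.
have M0 : 0 <= M.
  apply: addr_ge0; first by rewrite invr_ge0 ltW.
  by apply: divr_ge0; [apply: addr_ge0 => //|]; exact: ltW.
apply: (@squeeze_cvgr _ _ _ _ (fun s => - (expR (- a * s) * M))
  (fun s => expR (- a * s) * M)).
- apply: nearW => s; rewrite -ler_norml /F normrM ger0_norm ?expR_ge0//.
  rewrite ler_wpM2l ?expR_ge0// (le_trans (ler_normD _ _))// lerD//.
    by rewrite normrN ger0_norm// invr_ge0 ltW.
  have D0' := ltW D0.
  rewrite normrM [X in _ * X]ger0_norm ?invr_ge0// ler_wpM2r ?invr_ge0//.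
  rewrite (le_trans (ler_normB _ _))// lerD// normrM.
    by rewrite ler_piMr// sin_max.
  by rewrite (ger0_norm (ltW a0)) ler_piMr ?cos_max// ltW.
- rewrite -oppr0; apply: cvgN; rewrite -(mul0r M); apply: cvgM; last exact: cvg_cst.
  exact: cvg_expRN.
- rewrite -(mul0r M); apply: cvgM; last exact: cvg_cst.
  exact: cvg_expRN.
Qed.

Let ck (a z : R) : continuous (fun s : R => expR (- a * `|s|) * (1 + cos (z * s))).
Proof.
move=> s; apply: cvgM.
  apply: (@continuous_comp _ _ _ (fun s : R => - a * `|s|) expR).
    by apply: cvgM; [exact: cvg_cst|apply: cvg_norm].
  exact: continuous_expR.
apply: cvgD; first exact: cvg_cst.
apply: (@continuous_comp _ _ _ (fun s : R => z * s) cos).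
  by apply: cvgM; [exact: cvg_cst|].
exact: continuous_cos.
Qed.

Let k_int (a z : R) : 0 < a ->
  L1 mu (fun s => expR (- a * `|s|) * (1 + cos (z * s))) /\
  \int[mu]_s (expR (- a * `|s|) * (1 + cos (z * s))) =
    2 * (a^-1 + a / (a ^+ 2 + z ^+ 2)).
Proof.
move=> a0.
have k0 s : 0 <= expR (- a * `|s|) * (1 + cos (z * s)).
  by rewrite mulr_ge0 ?expR_ge0//; have := cos_geN1 (z * s); lra.
apply: ge0_L1_integral => //; first by apply: continuous_measurable_fun; apply: ck.
rewrite (@ge0_symfun_integralT _ (fun s => expR (- a * `|s|) * (1 + cos (z * s))))//.
- rewrite -set_itvcy; transitivity (2%:E *
      (\int[mu]_(s in `[0%R, +oo[) (expR (- a * s) * (1 + cos (z * s)))%:E))%E.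
    congr (_ * _)%E; apply: eq_integral => s; rewrite inE/= in_itv/= andbT => s0.
    by rewrite ger0_norm.
  rewrite (@ge0_continuous_FTC2y _ _ (F a z) 0 0).
  + rewrite sub0e EFinM -EFinN; congr (_ * _%:E)%E.
    by rewrite /F !mulr0 expR0 sin0 cos0; ring.
  + by move=> s s0; rewrite mulr_ge0 ?expR_ge0//; have := cos_geN1 (z * s); lra.
  + apply: (@subspace_eq_continuous _ _ _
      (fun s : R => expR (- a * `|s|) * (1 + cos (z * s)))).
      by move=> s; rewrite inE/= in_itv/= andbT => s0; rewrite /from_subspace/= ger0_norm.
    exact/continuous_subspaceT/ck.
  + exact: cvgF.
  + by move=> s _; have [] := dF z s a0.
  + apply: cvg_at_right_filter; apply: differentiable_continuous.
    by apply/derivable1_diffP; have [] := dF z 0 a0.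
  + by move=> s _; rewrite derive1E; have [_ ->] := dF z s a0.
- by move=> s; rewrite /= normrN mulrN cosN.
Qed.

Lemma L1_expR_abs (a : R) : 0 < a -> L1 mu (fun s => expR (- a * `|s|)).
Proof.
move=> a0; have [l _] := k_int 0 a0.
apply: L1_dominated l.
  apply: continuous_measurable_fun => s.
  apply: (@continuous_comp _ _ _ (fun s : R => - a * `|s|) expR).
    by apply: cvgM; [exact: cvg_cst|apply: cvg_norm].
  exact: continuous_expR.
move=> s; rewrite ger0_norm ?expR_ge0// mul0r cos0 ler_peMr ?expR_ge0//.
by rewrite lerDl.
Qed.

(** Subtract from the integral of e^(- a |s|) (1 + cos (z s)) half of its value
    at z = 0. *)
Lemma poisson_kernel (a z : R) : 0 < a ->
  \int[mu]_s (expR (- a * `|s|) * cos (z * s)) = 2 * a / (a ^+ 2 + z ^+ 2).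
Proof.
move=> a0; have [l0 E0] := k_int 0 a0; have [l E] := k_int z a0.
transitivity (\int[mu]_s (expR (- a * `|s|) * (1 + cos (z * s)) -
    2^-1 * (expR (- a * `|s|) * (1 + cos (0 * s))))).
  by apply: eq_Rintegral => s _; rewrite mul0r cos0; field.
rewrite RintegralBT//; last exact: L1Z.
rewrite RintegralZT// E0 E.
have D0 : a ^+ 2 + z ^+ 2 != 0 by rewrite gt_eqF// ltr_pwDl ?exprn_gt0// sqr_ge0.
by rewrite expr0n/= addr0; field; rewrite D0 gt_eqF.
Qed.

End kernels.

(** * Smoothing by the Poisson kernel *)

Section smoothing.
Context (R : realType).
Notation mu := (@lebesgue_measure R).
Implicit Types (a e M x y z xi : R) (g : R -> R).

Lemma invr_gt0_nat n : 0 < n.+1%:R^-1 :> R.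
Proof. by rewrite invr_gt0. Qed.

(** Lebesgue measure lives on a copy of [R] with its own display; this form
    puts measurability of a continuous function there. *)
Lemma continuous_measurableT g : continuous g ->
  measurable_fun [set: measurableTypeR R] (g : measurableTypeR R -> R).
Proof. exact: continuous_measurable_fun. Qed.

(** Not normalised: its mass is 2 pi, the constant of Fourier inversion. *)
Definition poisson a z := 2 * a / (a ^+ 2 + z ^+ 2).

Definition poisson_smooth a g x := \int[mu]_y (poisson a (y - x) * g y).

Lemma sqrD_gt0 a z : 0 < a -> 0 < a ^+ 2 + z ^+ 2.
Proof. by move=> a0; rewrite ltr_pwDl ?exprn_gt0// sqr_ge0. Qed.

Lemma poisson_ge0 a z : 0 < a -> 0 <= poisson a z.
Proof.
by move=> a0; rewrite /poisson divr_ge0 ?mulr_ge0// ltW// ?sqrD_gt0.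
Qed.

Lemma poisson_le a z : 0 < a -> poisson a z <= 2 / a.
Proof.
move=> a0; rewrite /poisson ler_pdivrMr ?sqrD_gt0// mulrAC ler_pdivlMr//.
by rewrite -mulrA -expr2 ler_pM2l// lerDl sqr_ge0.
Qed.

Lemma continuous_poisson a : 0 < a -> continuous (poisson a).
Proof.
move=> a0 z; apply: cvgM; first exact: cvg_cst.
apply: cvgV; first by rewrite gt_eqF// sqrD_gt0.
apply: cvgD; first exact: cvg_cst.
exact: exprn_continuous.
Qed.

Lemma continuous_poisson_shift a x : 0 < a -> continuous (fun y => poisson a (y - x)).
Proof.
move=> a0 y; apply: (@continuous_comp _ _ _ (fun y => y - x) (poisson a)).
  by apply: cvgB => //; exact: cvg_cst.
exact: continuous_poisson.
Qed.

Lemma poisson_rescale a x u : 0 < a ->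
  a * poisson a (x + a * u - x) = 2 * (1 + u ^+ 2)^-1.
Proof.
move=> a0; rewrite /poisson.
have u0 : 1 + u ^+ 2 != 0 by rewrite gt_eqF// ltr_pwDl// sqr_ge0.
have -> : a ^+ 2 + (x + a * u - x) ^+ 2 = a ^+ 2 * (1 + u ^+ 2) by ring.
by field; rewrite u0 gt_eqF.
Qed.

Lemma poisson_mass a x : 0 < a ->
  L1 mu (fun y => poisson a (y - x)) /\ \int[mu]_y poisson a (y - x) = 2 * pi.
Proof.
move=> a0; have [lc Ec] := integral_cauchy_kernel R.
apply: ge0_L1_integral.
- by apply: continuous_measurableT; exact: continuous_poisson_shift.
- by move=> y; exact: poisson_ge0.
rewrite (@ge0_integral_affine _ (fun y => poisson a (y - x)) x a)//; last 2 first.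
- exact: continuous_poisson_shift.
- by move=> y; exact: poisson_ge0.
under eq_integral do rewrite poisson_rescale//.
by rewrite EFin_Rintegral ?RintegralZT ?Ec//; exact: L1Z.
Qed.

(** The substitution y = x + a u turns the Poisson kernel of width a into a fixed
    Cauchy density, so the error of the smoothing is an average of the
    oscillation of g at distance a |u|. *)
Lemma poisson_smooth_dist a g x M : 0 < a -> continuous g ->
  (forall y, `|g y| <= M) ->
  L1 mu (fun u => `|g (x + a * u) - g x| * (2 * (1 + u ^+ 2)^-1)) /\
  `|poisson_smooth a g x - 2 * pi * g x| <=
    \int[mu]_u (`|g (x + a * u) - g x| * (2 * (1 + u ^+ 2)^-1)).
Proof.
move=> a0 cg gM; have [lk Ek] := poisson_mass x a0.
have [lc Ec] := integral_cauchy_kernel R.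
have cgx : continuous (fun y => `|g y - g x|).
  by move=> y; apply: cvg_norm; apply: cvgB; [exact: cg|exact: cvg_cst].
have lkg : L1 mu (fun y => poisson a (y - x) * g y).
  have := L1_mul_bounded (continuous_measurableT cg) gM lk.
  by congr (L1 mu _); apply/funext => y; rewrite mulrC.
have cG : continuous (fun y => `|g y - g x| * poisson a (y - x)).
  by move=> y; apply: cvgM; [exact: cgx|exact: continuous_poisson_shift].
have gM2 y : `| `|g y - g x| | <= M + M.
  by rewrite normr_id (le_trans (ler_normB _ _))// lerD.
have lG : L1 mu (fun y => `|g y - g x| * poisson a (y - x)).
  exact: L1_mul_bounded (continuous_measurableT cgx) gM2 lk.
have lu : L1 mu (fun u => `|g (x + a * u) - g x| * (2 * (1 + u ^+ 2)^-1)).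
  apply: L1_mul_bounded (L1Z 2 lc); last by move=> u; exact: gM2.
  apply: continuous_measurableT => u.
  apply: (@continuous_comp _ _ _ (fun u => x + a * u) (fun y => `|g y - g x|)).
    apply: cvgD; first exact: cvg_cst.
    by apply: cvgM; [exact: cvg_cst|].
  exact: cgx.
split => //; rewrite /poisson_smooth -Ek mulrC -RintegralZT//.
rewrite -RintegralBT//; last exact: L1Z.
have lD : L1 mu (fun y => poisson a (y - x) * g y - g x * poisson a (y - x)).
  by apply: L1B => //; exact: L1Z.
apply: (le_trans (norm_Rintegral_le lD lG _)).
  by move=> y; rewrite [g x * _]mulrC -mulrBr normrM (ger0_norm (poisson_ge0 _ _))// mulrC.
have E := @ge0_integral_affine R (fun y => `|g y - g x| * poisson a (y - x))
  x a a0 cG (fun y => mulr_ge0 (normr_ge0 _) (poisson_ge0 _ a0)).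
rewrite -lee_fin -!EFin_Rintegral// E.
rewrite le_eqVlt; apply/orP; left; apply/eqP; apply: eq_integral => u _.
by rewrite -(@poisson_rescale a x)// mulrCA.
Qed.

Lemma poisson_smooth_cvg g x M : continuous g -> (forall y, `|g y| <= M) ->
  poisson_smooth n.+1%:R^-1 g x @[n --> \oo] --> 2 * pi * g x.
Proof.
move=> cg gM; have [lc _] := integral_cauchy_kernel R.
pose h n u := `|g (x + n.+1%:R^-1 * u) - g x| * (2 * (1 + u ^+ 2)^-1).
have H n := @poisson_smooth_dist n.+1%:R^-1 g x M (invr_gt0_nat n) cg gM.
have M0 : 0 <= M by exact: le_trans (gM 0).
have : \int[mu]_u h n u @[n --> \oo] --> \int[mu]_u (cst 0 u : R).
  apply: (@Rintegral_cvg_dominated _ _ _ mu h (cst 0)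
    (fun u => (M + M) * (2 * (1 + u ^+ 2)^-1))).
  - by move=> n; exact: L1_measurable (H n).1.
  - exact: measurable_cst.
  - move=> u; rewrite /h -[X in _ --> X](mul0r (2 * (1 + u ^+ 2)^-1)).
    apply: cvgM; last exact: cvg_cst.
    apply/norm_cvg0P; rewrite -(subrr (g x)); apply: cvgB; last exact: cvg_cst.
    apply: (@cvg_comp _ _ _ (fun n => x + n.+1%:R^-1 * u) g _ (nbhs x)); last exact: cg.
    suff : x + n.+1%:R^-1 * u @[n --> \oo] --> x + 0 * u by rewrite mul0r addr0.
    apply: cvgD; first exact: cvg_cst.
    by apply: cvgM; [exact: cvg_harmonic|exact: cvg_cst].
  - move=> n u; rewrite /h normrM normr_id ger0_norm ?ler_wpM2r//.
    + by rewrite mulr_ge0// invr_ge0 addr_ge0// sqr_ge0.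
    + by rewrite (le_trans (ler_normB _ _))// lerD.
    + by rewrite mulr_ge0// invr_ge0 addr_ge0// sqr_ge0.
  - exact/L1Z/L1Z.
rewrite [X in _ --> X](_ : _ = 0); last first.
  by rewrite Rintegral_cst// mul0r.
move=> /cvgr0_norm_le cvgh; apply/cvgrPdist_le; rewrite /= => e e0.
apply: filterS (cvgh _ e0) => n hn; rewrite distrC; apply: (le_trans (H n).2); exact: le_trans (ler_norm _) hn.
Qed.

End smoothing.

(** * Fourier inversion *)

Section inversion.
Context (R : realType).
Notation mu := (@lebesgue_measure R).
Implicit Types (a e M x y z xi : R) (g u : R -> R).

Lemma continuous_cosM xi : continuous (fun x => cos (xi * x)).
Proof.
move=> x; apply: (@continuous_comp _ _ _ (fun x => xi * x) cos).
  by apply: cvgM; [exact: cvg_cst|].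
exact: continuous_cos.
Qed.

Lemma continuous_sinM xi : continuous (fun x => sin (xi * x)).
Proof.
move=> x; apply: (@continuous_comp _ _ _ (fun x => xi * x) sin).
  by apply: cvgM; [exact: cvg_cst|].
exact: continuous_sin.
Qed.

Lemma L1_cosM xi u : L1 mu u -> L1 mu (fun x => cos (xi * x) * u x).
Proof.
move=> lu; apply: (@L1_mul_bounded _ _ _ mu 1 u (fun x => cos (xi * x))) => //.
- by apply: continuous_measurableT; exact: continuous_cosM.
- by move=> x; exact: cos_max.
Qed.

Lemma L1_sinM xi u : L1 mu u -> L1 mu (fun x => sin (xi * x) * u x).
Proof.
move=> lu; apply: (@L1_mul_bounded _ _ _ mu 1 u (fun x => sin (xi * x))) => //.
- by apply: continuous_measurableT; exact: continuous_sinM.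
- by move=> x; exact: sin_max.
Qed.

Definition cos_transform u xi := \int[mu]_x (cos (xi * x) * u x).
Definition sin_transform u xi := \int[mu]_x (sin (xi * x) * u x).

(** On the Fourier side the smoothing multiplies the transform by
    e^(- a |xi|), which makes the inversion integral absolutely convergent and
    Fubini applicable. *)
Lemma poisson_smooth_fourier a u x : 0 < a -> L1 mu u ->
  poisson_smooth a u x = \int[mu]_xi (expR (- a * `|xi|) *
    (cos (xi * x) * cos_transform u xi + sin (xi * x) * sin_transform u xi)).
Proof.
move=> a0 lu; have le := L1_expR_abs a0.
pose f y xi := (expR (- a * `|xi|) * cos ((y - x) * xi)) * u y.
have meas_u := L1_measurable lu.
have le1 z : L1 mu (fun xi => expR (- a * `|xi|) * cos (z * xi)).
  have := L1_cosM z le.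
  by congr (L1 mu _); apply/funext => xi; rewrite mulrC.
have f2 y : L1 mu (f y).
  have := L1Z (u y) (le1 (y - x)).
  by congr (L1 mu _); apply/funext => xi; rewrite mulrC.
have bnd y xi : `|f y xi| <= expR (- a * `|xi|) * `|u y|.
  rewrite /f !normrM ler_wpM2r// ger0_norm ?expR_ge0//.
  by rewrite ler_piMr ?expR_ge0// cos_max.
have luZ xi : L1 mu (fun y => expR (- a * `|xi|) * `|u y|) by exact/L1Z/L1_norm.
have mf : measurable_fun setT (fun z : measurableTypeR R * measurableTypeR R => f z.1 z.2).
  rewrite /f; apply: measurable_funM; first apply: measurable_funM.
  - apply: measurableT_comp; first exact: measurable_expR.
    apply: measurable_funM; first exact: measurable_cst.
    by apply: measurableT_comp; [exact: normr_measurable|exact: measurable_snd].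
  - apply: (measurableT_comp (continuous_measurableT (@continuous_cos R))).
    apply: measurable_funM; last exact: measurable_snd.
    by apply: measurable_funB; [exact: measurable_fst|exact: measurable_cst].
  - exact: measurableT_comp meas_u _.
have f1 xi : L1 mu (f ^~ xi).
  apply: (@L1_dominated _ _ _ mu (fun y => expR (- a * `|xi|) * `|u y|)) => //.
  apply: measurable_funM => //; apply: measurable_funM; first exact: measurable_cst.
  apply: (@continuous_measurableT _ (fun y => cos ((y - x) * xi))) => y.
  apply: (@continuous_comp _ _ _ (fun y => (y - x) * xi) cos).
    apply: cvgM; last exact: cvg_cst.
    by apply: cvgB; last exact: cvg_cst.
  exact: continuous_cos.
have := @Rintegral_swap _ _ _ _ R mu mu f
  (fun xi => \int[mu]_y `|u y| * expR (- a * `|xi|)) mf f2 f1.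
case.
- move=> xi; rewrite mulrC -RintegralZT; last exact: L1_norm.
  by apply: le_RintegralT => //; exact: L1_norm.
- exact: L1Z.
move=> _ _; have -> : \int[mu]_y \int[mu]_xi f y xi = poisson_smooth a u x.
  apply: eq_Rintegral => y _; rewrite /poisson -poisson_kernel// mulrC.
  by rewrite -RintegralZT//; apply: eq_Rintegral => xi _; rewrite mulrC.
move=> ->; apply: eq_Rintegral => xi _.
have lc := L1_cosM xi lu; have ls := L1_sinM xi lu.
rewrite /cos_transform /sin_transform -!RintegralZT// -RintegralDT; try exact: L1Z.
rewrite -RintegralZT; last by apply: L1D; exact: L1Z.
apply: eq_Rintegral => y _; rewrite /f (_ : (y - x) * xi = xi * y - xi * x); last by ring.
by rewrite cosB; ring.
Qed.

(** Both sides are the limit, as a tends to 0, of the smoothed function: the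
    left one by the factor e^(- a |xi|) increasing to 1, the right one by
    approximation of the identity. *)
Theorem fourier_inversion u M x : continuous u -> (forall x, `|u x| <= M) ->
  L1 mu u -> L1 mu (cos_transform u) -> L1 mu (sin_transform u) ->
  \int[mu]_xi (cos (xi * x) * cos_transform u xi +
               sin (xi * x) * sin_transform u xi) = 2 * pi * u x.
Proof.
move=> cu uM lu lc ls.
set h := (X in \int[mu]_xi X xi).
have lh : L1 mu h.
  apply: L1D.
    under eq_fun do rewrite [_ * x]mulrC.
    exact: (L1_cosM x lc).
  under eq_fun do rewrite [_ * x]mulrC.
  exact: (L1_sinM x ls).
have A := @poisson_smooth_cvg R u x M cu uM.
have mh := L1_measurable lh.
have B : \int[mu]_xi (expR (- n.+1%:R^-1 * `|xi|) * h xi) @[n --> \oo] --> \int[mu]_xi h xi.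
  apply: (@Rintegral_cvg_dominated _ _ _ mu
    (fun n xi => expR (- n.+1%:R^-1 * `|xi|) * h xi) h (fun xi => `|h xi|));
    [|exact: mh| | |exact: L1_norm].
- move=> n; apply: measurable_funM => //.
  exact: L1_measurable (L1_expR_abs (invr_gt0_nat R n)).
- move=> xi; rewrite -[X in _ --> X]mul1r; apply: cvgM; last exact: cvg_cst.
  rewrite -[X in _ --> X]expR0; apply: (@cvg_comp _ _ _ (fun n => - n.+1%:R^-1 * `|xi|) expR _ (nbhs (0 : R))).
    rewrite -(mul0r `|xi|) -oppr0; apply: cvgM; last exact: cvg_cst.
    by apply: cvgN; exact: cvg_harmonic.
  exact: continuous_expR.
- move=> n xi; rewrite normrM ger0_norm ?expR_ge0// ler_piMl//.
have E : (fun n => poisson_smooth n.+1%:R^-1 u x) =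
    (fun n => \int[mu]_xi (expR (- n.+1%:R^-1 * `|xi|) * h xi)).
  by apply/funext => n; rewrite poisson_smooth_fourier// invr_gt0_nat.
rewrite E in A; exact: (cvg_unique _ B A).
Qed.

Lemma Rintegral_odd u : L1 mu u -> (forall x, u (- x) = - u x) ->
  \int[mu]_x u x = 0.
Proof.
move=> lu uN; have [_] := L1_opp lu.
under eq_Rintegral do rewrite uN.
rewrite RintegralNT//; lra.
Qed.

Definition unif_cont g := forall e, 0 < e ->
  exists2 d : R, 0 < d & forall x y, `|y - x| <= d -> `|g y - g x| <= e.

(** The oscillation |g (x + a u) - g x| is at most e' when a |u| <= d and 2 M
    otherwise.  Both bounds are at most, for every x,
    e' + 2 M min (1, a |u| / d), whose average tends to e' as a tends to 0. *)
Lemma poisson_smooth_unif g M e : unif_cont g -> continuous g ->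
  (forall y, `|g y| <= M) -> 0 < e ->
  exists2 a, 0 < a & forall x, `|poisson_smooth a g x - 2 * pi * g x| <= e.
Proof.
move=> ug cg gM e0; have [lc Ec] := integral_cauchy_kernel R.
have M0 : 0 <= M by exact: le_trans (gM 0).
have p0 : 0 < 2 * pi :> R by rewrite mulr_gt0// pi_gt0.
(* The Cauchy density has mass 2 pi here, and half of e is kept for the limit. *)
pose e' := e / (2 * (2 * pi)).
have e'0 : 0 < e' by rewrite divr_gt0 ?mulr_gt0 ?pi_gt0.
have [d d0 gd] := ug _ e'0.
pose w n (u : R) : R := e' + (M + M) * Num.min 1 (n.+1%:R^-1 * `|u| / d).
pose k (u : R) : R := 2 * (1 + u ^+ 2)^-1.
have k0 (u : R) : 0 <= k u by rewrite mulr_ge0// invr_ge0 addr_ge0// sqr_ge0.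
have min0 n (u : R) : 0 <= Num.min 1 (n.+1%:R^-1 * `|u| / d).
  by rewrite le_min ler01 divr_ge0 ?mulr_ge0// ltW.
have w0 n (u : R) : 0 <= w n u 
  by apply: addr_ge0; [exact: ltW|apply: mulr_ge0 => //; exact: addr_ge0].
have lk : L1 mu k by exact: L1Z.
have mw n : measurable_fun [set: measurableTypeR R] (w n : measurableTypeR R -> R).
  apply: measurable_funD; first exact: measurable_cst.
  apply: measurable_funM; first exact: measurable_cst.
  apply: measurable_minr; first exact: measurable_cst.
  apply: measurable_funM; last exact: measurable_cst.
  apply: measurable_funM; first exact: measurable_cst.
  exact: normr_measurable.
have wM n (u : R) : w n u <= e' + (M + M).
  rewrite lerD2l ler_piMr ?addr_ge0//; by rewrite ge_min lexx.
have lw n : L1 mu (fun v => w n v * k v).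
  apply: (@L1_mul_bounded _ _ _ mu (e' + (M + M)) k (w n)) => // u.
  by rewrite ger0_norm.
have cw : \int[mu]_v (w n v * k v) @[n --> \oo] --> \int[mu]_v (e' * k v).
  apply: (@Rintegral_cvg_dominated _ _ _ mu _ _ (fun v => (e' + (M + M)) * k v)).
  - by move=> n; exact: L1_measurable (lw n).
  - exact: L1_measurable (L1Z e' lk).
  - move=> u; apply: cvgM; last exact: cvg_cst.
    rewrite -[X in _ --> X]addr0; apply: cvgD; first exact: cvg_cst.
    rewrite -(mulr0 (M + M)); apply: cvgM; first exact: cvg_cst.
    apply: (@squeeze_cvgr _ _ _ _ (cst 0) (fun n => n.+1%:R^-1 * `|u| / d)).
    + by apply: nearW => n; rewrite min0/= ge_min lexx orbT.
    + exact: cvg_cst.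
    + rewrite -(mul0r (`|u| / d)); under eq_fun do rewrite -mulrA.
      by apply: cvgM; [exact: cvg_harmonic|exact: cvg_cst].
  - by move=> n u; rewrite normrM !ger0_norm ?ler_wpM2r.
  - exact: L1Z.
have {}cw : \int[mu]_v (w n v * k v) @[n --> \oo] --> e / 2.
  move: cw; rewrite RintegralZT// RintegralZT// Ec /e'.
  suff -> : e / (2 * (2 * pi)) * (2 * pi) = e / 2 by [].
  have : pi != 0 :> R by rewrite gt_eqF// pi_gt0.
  by move: (pi : R) => p q0; field.
have e2 : e / 2 < e by rewrite ltr_pdivrMr// ltr_pMr// ltr1n.
have [n _ /(_ n (leqnn n)) /= hn] := cvgr_le _ cw _ e2.
exists n.+1%:R^-1; first exact: invr_gt0_nat.
move=> x; have [l] := @poisson_smooth_dist R n.+1%:R^-1 g x M (invr_gt0_nat R n) cg gM.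
move/le_trans; apply; apply: le_trans hn; apply: le_RintegralT => // u.
apply: ler_wpM2r; first exact: k0.
rewrite /w.
have [h|h] := leP 1 (n.+1%:R^-1 * `|u| / d).
  by rewrite mulr1 (le_trans (ler_normB _ _))// (le_trans (lerD (gM _) (gM _)))// lerDr ltW.
rewrite (le_trans (gd _ _ _)) ?lerDl ?mulr_ge0 ?addr_ge0//.
  rewrite addrAC subrr add0r normrM ger0_norm ?ltW ?invr_gt0_nat//.
  by move: h; rewrite ltr_pdivrMr// mul1r.
by rewrite invr_ge0 ltW.
Qed.

End inversion.

(** * Levy's continuity theorem *)

Section probability_integrals.
Context (R : realType) d (T : measurableType d) (P : probability T R).

Lemma L1_bounded (h : T -> R) M : measurable_fun setT h ->
  (forall w, `|h w| <= M) -> L1 P h.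
Proof.
move=> mh hM; apply: (@L1_dominated _ _ _ P (cst M)) => //.
exact: finite_measure_integrable_cst.
Qed.

Lemma Rintegral_probability_cst M : \int[P]_w (cst M w) = M.
Proof.
by rewrite Rintegral_cst//= probability_setT mulr1.
Qed.

End probability_integrals.

Section poisson_expectation.
Context (R : realType) d (T : measurableType d) (P : probability T R).
Variable X : T -> R.
Hypothesis mX : measurable_fun setT X.
Notation mu := (@lebesgue_measure R).
Implicit Types (a e M x y z xi : R) (g u : R -> R).

Let mcosX xi : measurable_fun setT (fun w => cos (xi * X w)).
Proof.
exact: (measurableT_comp (continuous_measurable_fun (@continuous_cosM R xi)) mX).
Qed.

Let msinX xi : measurable_fun setT (fun w => sin (xi * X w)).
Proof.
exact: (measurableT_comp (continuous_measurable_fun (@continuous_sinM R xi)) mX).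
Qed.

Lemma L1_cosX xi : L1 P (fun w => cos (xi * X w)).
Proof. by apply: (@L1_bounded _ _ _ _ _ 1) => // w; exact: cos_max. Qed.

Lemma L1_sinX xi : L1 P (fun w => sin (xi * X w)).
Proof. by apply: (@L1_bounded _ _ _ _ _ 1) => // w; exact: sin_max. Qed.

Definition chi_cos xi := \int[P]_w cos (xi * X w).
Definition chi_sin xi := \int[P]_w sin (xi * X w).

(** The density at y, up to the factor 2 pi, of X plus an independent Cauchy
    variable of scale a; it depends on X through the characteristic function
    only. *)
Definition poisson_exp a y := \int[P]_w poisson a (y - X w).

Let f a y xi (w : T) := expR (- a * `|xi|) * cos ((y - X w) * xi).

Let fE a y xi : \int[P]_w f a y xi w =
  expR (- a * `|xi|) * (cos (xi * y) * chi_cos xi + sin (xi * y) * chi_sin xi).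
Proof.
have lc := L1_cosX xi; have ls := L1_sinX xi.
rewrite /chi_cos /chi_sin -!RintegralZT// -RintegralDT; try exact: L1Z.
rewrite -RintegralZT; last by apply: L1D; exact: L1Z.
apply: eq_Rintegral => w _; rewrite /f.
by rewrite (_ : (y - X w) * xi = xi * y - xi * X w) ?cosB//; ring.
Qed.

Lemma poisson_expE a y : 0 < a ->
  L1 mu (fun xi => expR (- a * `|xi|) *
    (cos (xi * y) * chi_cos xi + sin (xi * y) * chi_sin xi)) /\
  poisson_exp a y = \int[mu]_xi (expR (- a * `|xi|) *
    (cos (xi * y) * chi_cos xi + sin (xi * y) * chi_sin xi)).
Proof.
move=> a0; have le := L1_expR_abs a0.
have bnd xi w : `|f a y xi w| <= expR (- a * `|xi|).
  by rewrite /f normrM ger0_norm ?expR_ge0// ler_piMr ?expR_ge0// cos_max.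
have f1 w : L1 mu ((f a y) ^~ w).
  have := L1_cosM (y - X w) le.
  by congr (L1 mu _); apply/funext => xi; rewrite mulrC.
have mf : measurable_fun setT (fun z : measurableTypeR R * T => f a y z.1 z.2).
  apply: measurable_funM.
  - apply: measurableT_comp; first exact: measurable_expR.
    apply: measurable_funM; first exact: measurable_cst.
    by apply: measurableT_comp; [exact: normr_measurable|exact: measurable_fst].
  - apply: (measurableT_comp (continuous_measurableT (@continuous_cos R))).
    apply: measurable_funM; last exact: measurable_fst.
    apply: measurable_funB; first exact: measurable_cst.
    exact: measurableT_comp mX _.
have f2 xi : L1 P (f a y xi).
  apply: (@L1_bounded _ _ _ _ _ (expR (- a * `|xi|))) => //.
  apply: measurable_funM; first exact: measurable_cst.
  apply: (measurableT_comp (continuous_measurable_fun (@continuous_cos R))).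
  apply: measurable_funM; last exact: measurable_cst.
  by apply: measurable_funB; first exact: measurable_cst.
have := @Rintegral_swap _ _ _ _ R mu P (f a y)
  (cst (\int[mu]_xi expR (- a * `|xi|))) mf f2 f1.
case.
- move=> w; apply: le_RintegralT => //; exact: L1_norm.
- exact: finite_measure_integrable_cst.
under [X in L1 _ X -> _]eq_fun do rewrite fE.
under eq_Rintegral do rewrite fE.
move=> lE _ ->; split => //.
apply: eq_Rintegral => w _; rewrite /poisson -poisson_kernel//.
Qed.

Lemma measurable_poissonX a : 0 < a ->
  measurable_fun setT (fun z : measurableTypeR R * T => poisson a (z.1 - X z.2)).
Proof.
move=> a0; apply: (measurableT_comp (continuous_measurableT (continuous_poisson a0))).
apply: measurable_funB; first exact: measurable_fst.
exact: measurableT_comp mX _.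
Qed.

Lemma norm_poisson_le a z : 0 < a -> `|poisson a z| <= 2 / a.
Proof. by move=> a0; rewrite ger0_norm ?poisson_ge0// poisson_le. Qed.

Lemma poisson_smooth_exp a g M : 0 < a -> continuous g -> (forall x, `|g x| <= M) ->
   L1 mu g ->
  [/\ L1 P (fun w => poisson_smooth a g (X w)),
   L1 mu (fun y => poisson_exp a y * g y) &
   \int[P]_w poisson_smooth a g (X w) = \int[mu]_y (poisson_exp a y * g y)].
Proof.
move=> a0 cg gM lg.
pose h y w := poisson a (y - X w) * g y.
have mg := L1_measurable lg.
have mpX y : measurable_fun setT (fun w => poisson a (y - X w)).
  apply: (measurableT_comp (continuous_measurable_fun (continuous_poisson a0))).
  by apply: measurable_funB; first exact: measurable_cst.
have mh : measurable_fun setT (fun z : measurableTypeR R * T => h z.1 z.2).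
  apply: measurable_funM; first exact: measurable_poissonX.
  exact: measurableT_comp mg _.
have bnd y w : `|h y w| <= 2 / a * `|g y|.
  by rewrite normrM ler_wpM2r// norm_poisson_le.
have lpX y : L1 P (fun w => poisson a (y - X w)).
  by apply: (@L1_bounded _ _ _ _ _ (2 / a)) => // w; exact: norm_poisson_le.
have h2 y : L1 P (h y).
  have := L1Z (g y) (lpX y).
  by congr (L1 P _); apply/funext => w; rewrite mulrC.
have h1 w : L1 mu (h ^~ w).
  apply: (@L1_mul_bounded _ _ _ mu (2 / a) g (fun y => poisson a (y - X w))) => //.
  - by apply: continuous_measurableT; exact: continuous_poisson_shift.
  - by move=> y; exact: norm_poisson_le.
have B0 : L1 mu (fun y => 2 / a * `|g y|) by exact/L1Z/L1_norm.
have := @Rintegral_swap _ _ _ _ R mu P h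
  (cst (\int[mu]_y (2 / a * `|g y|))) mh h2 h1.
case.
- by move=> w; apply: le_RintegralT => //; exact: L1_norm.
- exact: finite_measure_integrable_cst.
have E y : \int[P]_w h y w = poisson_exp a y * g y.
  rewrite mulrC -RintegralZT//; apply: eq_Rintegral => w _.
  by rewrite mulrC.
under [X in L1 _ X -> _]eq_fun do rewrite E.
under eq_Rintegral do rewrite E.
by move=> lE lS ->; split.
Qed.

Lemma chi_cos_le1 xi : `|chi_cos xi| <= 1.
Proof.
rewrite -[leRHS](Rintegral_probability_cst P 1); apply: norm_Rintegral_le.
- exact: L1_cosX.
- exact: finite_measure_integrable_cst.
- by move=> w; exact: cos_max.
Qed.

Lemma chi_sin_le1 xi : `|chi_sin xi| <= 1.
Proof.
rewrite -[leRHS](Rintegral_probability_cst P 1); apply: norm_Rintegral_le.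
- exact: L1_sinX.
- exact: finite_measure_integrable_cst.
- by move=> w; exact: sin_max.
Qed.

Lemma poisson_exp_le a y : 0 < a -> `|poisson_exp a y| <= 2 / a.
Proof.
move=> a0; rewrite -[leRHS](Rintegral_probability_cst P); apply: norm_Rintegral_le.
- apply: (@L1_bounded _ _ _ _ _ (2 / a)); last by move=> w; exact: norm_poisson_le.
  apply: (measurableT_comp (continuous_measurable_fun (continuous_poisson a0))).
  by apply: measurable_funB; first exact: measurable_cst.
- exact: finite_measure_integrable_cst.
- by move=> w; exact: norm_poisson_le.
Qed.

End poisson_expectation.

Section compact_support.
Context (R : realType).
Notation mu := (@lebesgue_measure R).
Implicit Types (g : R -> R) (K M e : R).

(** Heine's theorem on the slightly larger segment [- (K + 1), K + 1]; outside
    it, both points are in the region where g vanishes. *)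
Lemma compact_support_unif_cont g K : continuous g ->
  (forall x, K <= `|x| -> g x = 0) -> unif_cont g.
Proof.
move=> cg gK e e0.
pose A := `[(- (K + 1)), (K + 1)]%classic : set R.
pose U (d x : R) := forall y, `|y - x| <= d -> `|g y - g x| <= e.
have cA : near_covering A by apply/compact_near_coveringP; exact: segment_compact.
have e2 : 0 < e / 2 by rewrite divr_gt0.
have : \forall d \near 0^'+, A `<=` U d.
  apply: cA => x Ax.
  have /cvgrPdist_le /(_ _ e2) [r /= r0 xr] := cg x.
  have r2 : 0 < r / 2 by rewrite divr_gt0.
  exists (ball x (r / 2), [set d | 0 < d < r / 2]) => /=.
    split; first exact: nbhsx_ballx.
    near=> d; apply/andP; split; near: d.
      exact: nbhs_right_gt.
    exact: nbhs_right_lt.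
  move=> [x' d] /= [xx' /andP[d0 dr]] y yx'.
  have h1 : ball_ Num.norm x r x'.
    by rewrite /= (lt_le_trans xx')//; move: r2; lra.
  have h2 : ball_ Num.norm x r y.
    rewrite /= (_ : x - y = (x - x') - (y - x')); last by ring.
    rewrite (le_lt_trans (ler_normB _ _))// [ltRHS](splitr r) ltrD//.
    exact: le_lt_trans dr.
  rewrite (_ : g y - g x' = (g x - g x') - (g x - g y)); last by ring.
  by rewrite (le_trans (ler_normB _ _))// [leRHS](splitr e) lerD//; exact: xr.
move=> [d0 /= d00 hd].
exists (Num.min (d0 / 2) 1); first by rewrite lt_min divr_gt0/=.
move=> x y; rewrite le_min => /andP[yx yx1].
have [xA|xA] := leP (`|x|) (K + 1).
  apply: (hd (d0 / 2)) => //=.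
  - by rewrite sub0r normrN ger0_norm; move: d00; lra.
  - by rewrite divr_gt0.
  - by rewrite /A/= in_itv/= -ler_norml.
rewrite gK; last first.
  have : `|x| <= `|y| + `|y - x|.
    by rewrite -[in leLHS](subKr y x) (le_trans (ler_normB _ _)).
  lra.
rewrite gK; last by lra.
by rewrite subrr normr0 ltW.
Unshelve. all: by end_near. Qed.

Lemma compact_support_L1 g K M : continuous g -> (forall x, `|g x| <= M) ->
  (forall x, K <= `|x| -> g x = 0) -> L1 mu g.
Proof.
move=> cg gM gK.
have M0 : 0 <= M by exact: le_trans (gM 0).
apply: (@L1_dominated _ _ _ mu (fun x => M * \1_(`[(- K), K] : set R) x)).
- exact: continuous_measurableT.
- move=> x; rewrite indicE; case: (boolP (x \in _)) => [_|xK].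
    by rewrite mulr1.
  rewrite gK ?normr0 ?mulr0//.
  move: xK; rewrite notin_setE/= in_itv/= -ler_norml => /negP.
  by rewrite -ltNge => /ltW.
- apply: L1Z; exact: integrable_indic_itv.
Qed.

End compact_support.

Section levy_continuity.
Context (R : realType) d (T : measurableType d) (P : probability T R).
Context d' (T' : measurableType d') (Q : probability T' R).
Variables (X : nat -> T -> R) (Y : T' -> R).
Hypotheses (mX : forall n, measurable_fun setT (X n)) (mY : measurable_fun setT Y).
Notation mu := (@lebesgue_measure R).
Hypothesis cvg_cos : forall xi, chi_cos P (X n) xi @[n --> \oo] --> chi_cos Q Y xi.
Hypothesis cvg_sin : forall xi, chi_sin P (X n) xi @[n --> \oo] --> chi_sin Q Y xi.
Implicit Types (g : R -> R) (a K M e : R).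

Let cvg_poisson_exp a y : 0 < a ->
  poisson_exp P (X n) a y @[n --> \oo] --> poisson_exp Q Y a y.
Proof.
move=> a0.
under eq_fun do rewrite (poisson_expE P (mX _) y a0).2.
rewrite (poisson_expE Q mY y a0).2.
apply: (@Rintegral_cvg_dominated _ _ _ mu _ _ (fun xi => 2 * expR (- a * `|xi|))).
- by move=> n; exact: L1_measurable (poisson_expE P (mX n) y a0).1.
- exact: L1_measurable (poisson_expE Q mY y a0).1.
- move=> xi; apply: cvgM; first exact: cvg_cst.
  by apply: cvgD; (apply: cvgM; first exact: cvg_cst).
- move=> n xi; rewrite normrM ger0_norm ?expR_ge0// mulrC ler_wpM2r ?expR_ge0//.
  rewrite (le_trans (ler_normD _ _))// -[leRHS]/(1 + 1).
  apply: lerD; rewrite normrM mulr_ile1 ?cos_max ?sin_max//.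
    exact: chi_cos_le1.
  exact: chi_sin_le1.
- exact/L1Z/L1_expR_abs.
Qed.

Let cvg_smooth a g M : 0 < a -> continuous g -> (forall x, `|g x| <= M) ->
  L1 mu g ->
  \int[P]_w poisson_smooth a g (X n w) @[n --> \oo] -->
  \int[Q]_w poisson_smooth a g (Y w).
Proof.
move=> a0 cg gM lg.
have [_ lY ->] := poisson_smooth_exp Q mY a0 cg gM lg.
rewrite (_ : (fun n => _) = (fun n => \int[mu]_y (poisson_exp P (X n) a y * g y))); last first.
  by apply/funext => n; have [_ _ ->] := poisson_smooth_exp P (mX n) a0 cg gM lg.
apply: (@Rintegral_cvg_dominated _ _ _ mu _ _ (fun y => 2 / a * `|g y|)).
- by move=> n; have [_ /L1_measurable] := poisson_smooth_exp P (mX n) a0 cg gM lg.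
- exact: (L1_measurable lY).
- by move=> y; apply: cvgM; [exact: cvg_poisson_exp|exact: cvg_cst].
- by move=> n y; rewrite normrM ler_wpM2r// poisson_exp_le.
- exact/L1Z/L1_norm.
Qed.

Let mgX g n : continuous g -> measurable_fun setT (fun w => g (X n w)).
Proof. by move=> cg; exact: (measurableT_comp (continuous_measurable_fun cg) (mX n)). Qed.

Let mgY g : continuous g -> measurable_fun setT (fun w => g (Y w)).
Proof. by move=> cg; exact: (measurableT_comp (continuous_measurable_fun cg) mY). Qed.

(** The smoothed function is uniformly close to g, and its expectation is an
    integral against [poisson_exp], which converges. *)
Let cvg_unif g M : continuous g -> (forall x, `|g x| <= M) ->
  L1 mu g -> unif_cont g ->
  \int[P]_w g (X n w) @[n --> \oo] --> \int[Q]_w g (Y w).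
Proof.
move=> cg gM lg ug; apply/cvgrPdist_le => e e0.
have e3 : 0 < e / 3 by rewrite divr_gt0.
have p0 : 0 < 2 * pi :> R by rewrite mulr_gt0// pi_gt0.
have [a a0 ha] := poisson_smooth_unif ug cg gM (mulr_gt0 p0 e3).
have [lY _ _] := poisson_smooth_exp Q mY a0 cg gM lg.
have lX n := (let: And3 l _ _ := poisson_smooth_exp P (mX n) a0 cg gM lg in l).
have lgY : L1 Q (fun w => g (Y w)) by apply: (@L1_bounded _ _ _ _ _ M) => //; exact: mgY.
have lgX n : L1 P (fun w => g (X n w)) by apply: (@L1_bounded _ _ _ _ _ M) => //; exact: mgX.
have near_int d0 (T0 : measurableType d0) (P0 : probability T0 R) (Z : T0 -> R) :
    L1 P0 (fun w => poisson_smooth a g (Z w)) -> L1 P0 (fun w => g (Z w)) ->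
    `|\int[P0]_w poisson_smooth a g (Z w) - 2 * pi * \int[P0]_w g (Z w)| <=
       2 * pi * (e / 3).
  move=> l1 l2; rewrite -RintegralZT// -RintegralBT//; last exact: L1Z.
  rewrite -[leRHS](Rintegral_probability_cst P0); apply: norm_Rintegral_le.
  - by apply: L1B => //; exact: L1Z.
  - exact: finite_measure_integrable_cst.
  - by move=> w; exact: ha.
have HY := near_int _ _ Q Y lY lgY.
have HX n := near_int _ _ P (X n) (lX n) (lgX n).
have /cvgrPdist_le /(_ _ (mulr_gt0 p0 e3)) := cvg_smooth a0 cg gM lg.
apply: filterS => n Hn; have {}HX := HX n.
rewrite -(ler_pM2l p0) -[X in X * `|_|](gtr0_norm p0) -normrM mulrBr.
move: HX HY Hn; rewrite (_ : 2 * pi * e = 2 * pi * (e / 3) + 2 * pi * (e / 3) + 2 * pi * (e / 3)); last by field.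
move: (2 * pi * (e / 3)) (2 * pi * \int[P]_w g (X n w)) (2 * pi * \int[Q]_w g (Y w)) => c u v.
rewrite !ler_norml => /andP[? ?] /andP[? ?] /andP[? ?]; apply/andP; split; lra.
Qed.

Let cutoff K (x : R) : R := Num.max 0 (Num.min 1 (K + 1 - `|x|)).

Let cutoff_continuous K : continuous (cutoff K).
Proof.
move=> x; apply: (@continuous_max _ _ (cst 0) (fun x => Num.min 1 (K + 1 - `|x|)) x).
  exact: cvg_cst.
apply: (@continuous_min _ _ (cst 1) (fun x => K + 1 - `|x|) x); first exact: cvg_cst.
by apply: cvgB; [exact: cvg_cst|exact: cvg_norm].
Qed.

Let cutoff_itv K x : 0 <= cutoff K x <= 1.
Proof. by rewrite le_max lexx/= ge_max ler01 ge_min lexx. Qed.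

Let cutoff_out K x : K + 1 <= `|x| -> cutoff K x = 0.
Proof. by move=> h; apply/max_idPl; rewrite ge_min subr_le0 h orbT. Qed.

Let cutoff_in K x : `|x| <= K -> cutoff K x = 1.
Proof.
move=> h; rewrite /cutoff (_ : Num.min _ _ = 1) ?max_r//.
by apply/min_idPl; lra.
Qed.

(** No tightness is assumed.  Integrating a cutoff k equal to 1 on a large
    segment against the limit law shows that this law has little mass outside
    the segment; since k is compactly supported the same then holds for
    [X n], n large, and g can be replaced by g k. *)
Theorem levy_continuity g M : continuous g -> (forall x, `|g x| <= M) ->
  \int[P]_w g (X n w) @[n --> \oo] --> \int[Q]_w g (Y w).
Proof.
move=> cg gM; have M0 : 0 <= M by exact: le_trans (gM 0).
have c1 K x : `|cutoff K x| <= 1.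
  by have /andP[c0 c1] := cutoff_itv K x; rewrite ger0_norm.
have cutoff_cvg : \int[Q]_w cutoff n%:R (Y w) @[n --> \oo] --> (1 : R).
  rewrite -[X in _ --> X](Rintegral_probability_cst Q).
  apply: (@Rintegral_cvg_dominated _ _ _ Q _ _ (cst 1)).
  - by move=> n; apply: mgY; exact: cutoff_continuous.
  - exact: measurable_cst.
  - move=> w; apply: cvg_near_cst; near=> n; apply: cutoff_in.
    by near: n; exact: nbhs_infty_ger.
  - by move=> n w; exact: c1.
  - exact: finite_measure_integrable_cst.
apply/cvgrPdist_le => e e0.
(* dl for g k, dl M for the tail of Y, and 2 dl M for the tail of X n. *)
pose dl := e / (3 * M + 1).
have D0 : 0 < 3 * M + 1 by rewrite ltr_wpDl// mulr_ge0.
have dl0 : 0 < dl by rewrite divr_gt0.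
have /cvgrPdist_le /(_ _ dl0) [N _ /(_ N (leqnn N)) /= hN] := cutoff_cvg.
pose K : R := N%:R; pose k := cutoff K.
have ck : continuous k by exact: cutoff_continuous.
have k_out x : K + 1 <= `|x| -> k x = 0 by exact: cutoff_out.
pose gk x := g x * k x.
have cgk : continuous gk by move=> x; apply: cvgM; [exact: cg|exact: ck].
have gk_out x : K + 1 <= `|x| -> gk x = 0 by move=> h; rewrite /gk k_out// mulr0.
have gkM x : `|gk x| <= M.
  by rewrite normrM -[leRHS]mulr1 ler_pM//; exact: (c1 K).
have cvg_k := cvg_unif ck (c1 K) (compact_support_L1 ck (c1 K) k_out)
  (compact_support_unif_cont ck k_out).
have cvg_gk := cvg_unif cgk gkM (compact_support_L1 cgk gkM gk_out)
  (compact_support_unif_cont cgk gk_out).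
have lmul d0 (T0 : measurableType d0) (P0 : probability T0 R) (Z : T0 -> R) :
    measurable_fun setT Z ->
    `|\int[P0]_w g (Z w) - \int[P0]_w gk (Z w)| <= M * (1 - \int[P0]_w k (Z w)).
  move=> mZ.
  have lg0 : L1 P0 (fun w => g (Z w)).
    apply: (@L1_bounded _ _ _ _ _ M) => //.
    exact: (measurableT_comp (continuous_measurable_fun cg) mZ).
  have lk0 : L1 P0 (fun w => k (Z w)).
    apply: (@L1_bounded _ _ _ _ _ 1); last by move=> w; exact: (c1 K).
    exact: (measurableT_comp (continuous_measurable_fun ck) mZ).
  have lgk0 : L1 P0 (fun w => gk (Z w)).
    apply: (@L1_bounded _ _ _ _ _ M) => //.
    exact: (measurableT_comp (continuous_measurable_fun cgk) mZ).
  have l1 : L1 P0 (cst 1) by exact: finite_measure_integrable_cst.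
  rewrite -{1}(Rintegral_probability_cst P0 1) -RintegralBT// -[X in M * X]RintegralBT// -RintegralZT; last exact: L1B.
  apply: norm_Rintegral_le; [exact: L1B|exact/L1Z/L1B|].
  move=> w; rewrite /gk -{1}[g (Z w)]mulr1 -mulrBr normrM ler_pM//.
  by have /andP[? ?] := cutoff_itv K (Z w); rewrite ger0_norm// subr_ge0.
have HY := lmul _ _ Q Y mY.
have HX n := lmul _ _ P (X n) (mX n).
have /cvgrPdist_le /(_ _ dl0) K1 := cvg_k.
have /cvgrPdist_le /(_ _ dl0) K2 := cvg_gk.
near=> n.
have {}HX := HX n.
have k1 : `|\int[Q]_w k (Y w) - \int[P]_w k (X n w)| <= dl.
  by near: n.
have k2 : `|\int[Q]_w gk (Y w) - \int[P]_w gk (X n w)| <= dl.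
  by near: n.
move: hN => /ler_normlP[_ hN].
move: k1 => /ler_normlP[_ k1].
have hY : M * (1 - \int[Q]_w k (Y w)) <= M * dl by rewrite ler_wpM2l.
have hX : M * (1 - \int[P]_w k (X n w)) <= M * (dl + dl).
  by rewrite ler_wpM2l//; move: hN k1; rewrite /k /K; lra.
have {HX hX} := le_trans HX hX; have {HY hY} := le_trans HY hY.
have -> : e = dl + M * dl + M * (dl + dl).
  by rewrite /dl; field; rewrite gt_eqF.
move: k2.
move: (M * dl) (M * (dl + dl)) => b c.
rewrite !ler_norml => /andP[? ?] /andP[? ?] /andP[? ?]; apply/andP; split; lra.
Unshelve. all: by end_near. Qed.

End levy_continuity.

(** * Expectation of a product of independent variables *)

Section layer_cake.
Context (R : realType) d (T : measurableType d).
Variable m : {sigma_finite_measure set T -> \bar R}.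
Notation mu := (@lebesgue_measure R).
Implicit Types (W h : T -> R) (M : R).

Let layer (h : T -> R) (t : R) (w : T) : R :=
  \1_(`]0, +oo[ : set R) t * \1_(`[0, +oo[ : set R) (h w - t).

Let layerE h t w : layer h t w = (0 < t <= h w)%R%:R.
Proof.
by rewrite /layer !indicE !mem_setE !in_itv/= !andbT subr_ge0 -natrM mulnb.
Qed.

Let layer_integral h w : 0 <= h w ->
  \int[mu]_t layer h t w = h w.
Proof.
move=> h0; rewrite (_ : (fun t => _) = \1_(`]0, h w] : set R)); last first.
  by apply/funext => t; rewrite layerE indicE mem_setE in_itv.
rewrite /Rintegral integral_indic//= setIT lebesgue_measure_itv/= lte_fin.
have [h0'|] := ltP 0 (h w); first by rewrite -EFinD/= subr0.
by move=> h1; apply/eqP; rewrite /= eq_le h0.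
Qed.

Let layer_meas h : measurable_fun setT h ->
  measurable_fun setT (fun z : measurableTypeR R * T => layer h z.1 z.2).
Proof.
move=> mh; apply: measurable_funM.
  by apply: measurableT_comp; [exact: measurable_indic|exact: measurable_fst].
apply: (@measurableT_comp _ _ _ _ _ _ (\1_(`[0, +oo[ : set R) : R -> R) _
  (fun z : measurableTypeR R * T => h z.2 - z.1)).
  exact: measurable_indic.
apply: measurable_funB; last exact: measurable_fst.
exact: measurableT_comp mh _.
Qed.

(** Write h w as the measure of the t with 0 < t <= h w, and exchange. *)
Lemma layer_cake W h M :
  L1 m W -> measurable_fun setT h -> (forall w, 0 <= h w <= M) ->
  \int[m]_w (W w * h w) = \int[mu]_t
    ((0 < t)%R%:R * \int[m]_w (W w * \1_(h @^-1` `[t, +oo[) w)).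
Proof.
move=> lW mh hM; have mW := L1_measurable lW.
have L0 t w : 0 <= layer h t w <= 1.
  by rewrite layerE; case: (0 < t <= h w)%R; rewrite ?lexx ?ler01.
have layer_le t w : layer h t w <= \1_(`]0, M] : set R) t.
  rewrite layerE indicE mem_setE in_itv/= ler_nat; case: (0 < t) => //=.
  by case: (leP t (h w)) => // th; rewrite (le_trans th)//; case/andP: (hM w).
have layerI t w : layer h t w = (0 < t)%R%:R * \1_(h @^-1` `[t, +oo[) w.
  rewrite -[\1_(h @^-1` _) w]/(\1_(`[t, +oo[%classic : set R) (h w)).
  by rewrite layerE indicE mem_setE in_itv/= andbT -natrM mulnb.
pose f t w := W w * layer h t w.
have mf : measurable_fun setT (fun z : measurableTypeR R * T => f z.1 z.2).
  apply: measurable_funM; last exact: layer_meas.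
  exact: measurableT_comp mW _.
have mlay t : measurable_fun setT (layer h t).
  apply: measurable_funM; first exact: measurable_cst.
  apply: (@measurableT_comp _ _ _ _ _ _ (\1_(`[0, +oo[ : set R) : R -> R) _
    (fun w => h w - t)); first exact: measurable_indic.
  by apply: measurable_funB.
have mlay2 w : measurable_fun [set: measurableTypeR R] ((layer h)^~ w).
  rewrite (_ : _ ^~ w = \1_(`]0, h w] : set R)); first exact: measurable_indic.
  by apply/funext => t; rewrite layerE indicE mem_setE in_itv.
have fM t w : `|f t w| <= `|W w| * \1_(`]0, M] : set R) t.
  rewrite normrM ler_pM//; rewrite ger0_norm//; by have /andP[] := L0 t w.
have lI : L1 mu (\1_(`]0, M] : set R)) by exact: integrable_indic_itv.
have f2 t : L1 m (f t).
  rewrite /f; under eq_fun do rewrite mulrC.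
  apply: (@L1_mul_bounded _ _ _ m 1 W (layer h t)) => // w.
  by have /andP[l0 l1] := L0 t w; rewrite ger0_norm.
have f1 w : L1 mu (f ^~ w).
  apply: (@L1_dominated _ _ _ mu (fun t => `|W w| * \1_(`]0, M] : set R) t)) => //.
    by apply: measurable_funM; first exact: measurable_cst.
  exact: L1Z.
have [] := @Rintegral_swap _ _ _ _ R mu m f
  (fun w => \int[mu]_t (\1_(`]0, M] : set R) t) * `|W w|) mf f2 f1.
- move=> w; rewrite mulrC -RintegralZT//.
  by apply: le_RintegralT => //; [exact: L1_norm|exact: L1Z].
- exact/L1Z/L1_norm.
move=> _ _ E; transitivity (\int[m]_y \int[mu]_x f x y).
  apply: eq_Rintegral => w _; have h0 : 0 <= h w by case/andP: (hM w).
  rewrite RintegralZT; first by rewrite layer_integral.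
  apply: (@L1_dominated _ _ _ mu (fun t => \1_(`]0, M] : set R) t)) => //.
  by move=> t; rewrite ger0_norm//; case/andP: (L0 t w).
rewrite -E; apply: eq_Rintegral => t _.
rewrite -RintegralZT; first by apply: eq_Rintegral => w _; rewrite /f layerI mulrCA.
under eq_fun do rewrite mulrC.
apply: (@L1_mul_bounded _ _ _ m 1 W (\1_(h @^-1` `[t, +oo[))) => //.
  apply: measurable_indic; rewrite -[X in measurable X]setTI; exact: mh.
by move=> w; rewrite indicE; case: (_ \in _); rewrite ?normr1 ?normr0 ?ler01.
Qed.

End layer_cake.

Section weighted_laws.
Context (R : realType) d1 (T1 : measurableType d1) d2 (T2 : measurableType d2).
Variable m1 : {sigma_finite_measure set T1 -> \bar R}.
Variable m2 : {sigma_finite_measure set T2 -> \bar R}.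

(** Two weighted integrals of bounded functions agree as soon as they agree on
    the level sets.  With constant weights this transports an expectation along
    a law given by a density; with one nonconstant weight it is the product
    rule for independent variables. *)
Lemma eq_weighted_law (W1 h1 : T1 -> R) (W2 h2 : T2 -> R) (M : R) :
  L1 m1 W1 -> L1 m2 W2 -> measurable_fun setT h1 -> measurable_fun setT h2 ->
  (forall w, `|h1 w| <= M) -> (forall w, `|h2 w| <= M) ->
  (forall B : set R, measurable B ->
    \int[m1]_w (W1 w * \1_(h1 @^-1` B) w) = \int[m2]_w (W2 w * \1_(h2 @^-1` B) w)) ->
  \int[m1]_w (W1 w * h1 w) = \int[m2]_w (W2 w * h2 w).
Proof.
move=> l1 l2 mh1 mh2 h1M h2M E.
have mS d (T : measurableType d) (h : T -> R) : measurable_fun setT h ->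
    measurable_fun setT (fun w => h w + M) by move=> mh; apply: measurable_funD.
have bS d (T : measurableType d) (h : T -> R) : (forall w, `|h w| <= M) ->
    forall w, 0 <= h w + M <= M + M.
  by move=> hM w; rewrite lerD2r; move: (hM w); rewrite ler_norml => /andP[? ->]; rewrite andbT; lra.
have ES : \int[m1]_w (W1 w * (h1 w + M)) = \int[m2]_w (W2 w * (h2 w + M)).
  rewrite (layer_cake l1 (mS _ _ _ mh1) (bS _ _ _ h1M)).
  rewrite (layer_cake l2 (mS _ _ _ mh2) (bS _ _ _ h2M)).
  apply: eq_Rintegral => t _; congr (_ * _).
  have S d (T : measurableType d) (h : T -> R) :
      (fun w => h w + M) @^-1` `[t, +oo[ = h @^-1` `[t - M, +oo[.
    by apply/seteqP; split => w /=; rewrite !in_itv/= !andbT lerBlDr.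
  by rewrite !S; exact: E.
have EM : \int[m1]_w W1 w = \int[m2]_w W2 w.
  have := E setT measurableT; rewrite !preimage_setT.
  under eq_Rintegral do rewrite indicT mulr1.
  by under [X in _ = X -> _]eq_Rintegral do rewrite indicT mulr1.
have split d (T : measurableType d) (m : {measure set T -> \bar R}) (W h : T -> R) :
    L1 m W -> measurable_fun setT h -> (forall w, `|h w| <= M) ->
    \int[m]_w (W w * (h w + M)) = \int[m]_w (W w * h w) + M * \int[m]_w W w.
  move=> lW mh hM; rewrite -RintegralZT// -RintegralDT; last exact: L1Z.
    by apply: eq_Rintegral => w _; rewrite mulrDr [W w * M]mulrC.
  by under eq_fun do rewrite mulrC; exact: L1_mul_bounded mh hM lW.
by move: ES; rewrite !split// EM => /addIr.
Qed.

End weighted_laws.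

Section independent_product.
Context (R : realType) d (T : measurableType d) (P : probability T R).

Lemma Rintegral_indic A : measurable A -> \int[P]_w \1_A w = fine (P A).
Proof. by move=> mA; rewrite /Rintegral integral_indic//= setIT. Qed.

Lemma Rintegral_mul_indep (W h : T -> R) M1 M2 :
  measurable_fun setT W -> (forall w, `|W w| <= M1) ->
  measurable_fun setT h -> (forall w, `|h w| <= M2) ->
  (forall B : set R, measurable B ->
    \int[P]_w (W w * \1_(h @^-1` B) w) = \int[P]_w W w * fine (P (h @^-1` B))) ->
  \int[P]_w (W w * h w) = \int[P]_w W w * \int[P]_w h w.
Proof.
move=> mW WM mh hM indep.
have lW : L1 P W by exact: L1_bounded WM.
have lh : L1 P h by exact: L1_bounded hM.
have lc : L1 P (cst (\int[P]_w W w)) by exact: finite_measure_integrable_cst.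
rewrite -RintegralZT//.
apply: (@eq_weighted_law _ _ _ _ _ P P W h _ h M2 lW lc) => // B mB.
have mhB : measurable (h @^-1` B) by rewrite -[X in measurable X]setTI; exact: mh.
rewrite indep// -Rintegral_indic// RintegralZT//.
apply: (@L1_bounded _ _ _ _ _ 1); first exact: measurable_indic.
by move=> w; rewrite indicE; case: (_ \in _); rewrite ?normr1 ?normr0 ?ler01.
Qed.

End independent_product.

Section factors.
Context (R : realType) d (T : measurableType d) (P : probability T R).
Context (I : eqType) (G : I -> set (set T)).
Hypothesis Gm : forall i B, G i B -> measurable B.
Hypothesis Gindep : mutually_independent P G.
Implicit Types (W h : T -> R) (M : R) (J L : seq I) (E : I -> set T).

(** [W] is bounded and behaves like a variable independent of all [G i] with i
    not in [J]: it plays the part of a function of the variables of index in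
    [J].  Stability under multiplication by a new factor and under sums replaces
    the independence of grouped sigma-algebras, so that no generating pi-system
    is needed. *)
Definition factors W J : Prop :=
  [/\ measurable_fun setT W, exists M, forall w, `|W w| <= M &
   forall L E, uniq L -> (forall i, i \in L -> i \notin J) ->
     (forall i, i \in L -> G i (E i)) ->
     \int[P]_w (W w * \1_(\big[setI/setT]_(i <- L) E i) w) =
     \int[P]_w W w * \prod_(i <- L) fine (P (E i))].

Let measurable_big L E : (forall i, i \in L -> G i (E i)) ->
  measurable (\big[setI/setT]_(i <- L) E i).
Proof.
elim: L => [|i L IH] GE; first by rewrite big_nil.
rewrite big_cons; apply: measurableI.
  by apply: (@Gm i); apply: GE; rewrite mem_head.
by apply: IH => j jL; apply: GE; rewrite in_cons jL orbT.
Qed.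

Lemma factors_L1 W J : factors W J -> L1 P W.
Proof. by move=> [mW [M WM] _]; exact: L1_bounded WM. Qed.

Lemma factors1 : factors (cst 1) [::].
Proof.
split; first exact: measurable_cst.
  by exists 1 => w; rewrite normr1.
move=> L E uL _ GE; rewrite Rintegral_probability_cst mul1r.
under eq_Rintegral do rewrite mul1r.
rewrite Rintegral_indic; last exact: measurable_big.
rewrite (Gindep uL GE) {uL}; elim: L GE => [|i L IH] GE; first by rewrite !big_nil.
have mE j : j \in i :: L -> measurable (E j) by move=> /GE /Gm.
rewrite !big_cons fineM ?IH//.
- by move=> j jL; apply: GE; rewrite in_cons jL orbT.
- by apply: fin_num_measure; apply: mE; rewrite mem_head.
- rewrite big_seq; apply: prode_fin_num => j jL.
  by apply: fin_num_measure; apply: mE; rewrite in_cons jL orbT.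
Qed.

Let mul_indic_L1 W J L E : factors W J -> (forall i, i \in L -> G i (E i)) ->
  L1 P (fun w => W w * \1_(\big[setI/setT]_(i <- L) E i) w).
Proof.
move=> [mW [M WM] _] GE.
have mE := measurable_big GE.
apply: (@L1_bounded _ _ _ _ _ M); first by apply: measurable_funM.
move=> w; rewrite indicE normrM; case: (_ \in _).
  by rewrite normr1 mulr1.
by rewrite normr0 mulr0 (le_trans _ (WM w)).
Qed.

Lemma factorsD W W' J : factors W J -> factors W' J ->
  factors (fun w => W w + W' w) J.
Proof.
move=> fW fW'; have lW := factors_L1 fW; have lW' := factors_L1 fW'.
have [mW [M WM] WE] := fW; have [mW' [M' WM'] WE'] := fW'.
split; first exact: measurable_funD.
  by exists (M + M') => w; rewrite (le_trans (ler_normD _ _))// lerD.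
move=> L E uL LJ GE.
under eq_Rintegral do rewrite mulrDl.
rewrite (RintegralDT (mul_indic_L1 fW GE) (mul_indic_L1 fW' GE)) WE// WE'//.
by rewrite RintegralDT// mulrDl.
Qed.

Lemma factorsN W J : factors W J -> factors (fun w => - W w) J.
Proof.
move=> fW; have lW := factors_L1 fW; have [mW [M WM] WE] := fW.
split; first exact: measurableT_comp.
  by exists M => w; rewrite normrN.
move=> L E uL LJ GE.
under eq_Rintegral do rewrite mulNr.
rewrite (RintegralNT (mul_indic_L1 fW GE)) WE//.
by rewrite RintegralNT// mulNr.
Qed.

Lemma factors_cons W J i : factors W J -> factors W (i :: J).
Proof.
move=> [mW [M WM] WE]; split => //; first by exists M.
move=> L E uL LJ GE; apply: WE => // j /LJ.
by rewrite in_cons negb_or => /andP[].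
Qed.

(** The defining identity for the list i :: L says that W times an indicator of
    the events of L multiplies with every event of [G i]; hence it multiplies
    with every bounded [G i]-measurable function. *)
Lemma factors_mul W J i h M : factors W J -> i \notin J ->
  (forall w, `|h w| <= M) ->
  (forall B : set R, measurable B -> G i (h @^-1` B)) ->
  factors (fun w => W w * h w) (i :: J) /\
  \int[P]_w (W w * h w) = \int[P]_w W w * \int[P]_w h w.
Proof.
move=> fW iJ hM Gh; have lW := factors_L1 fW; have [mW [M' WM] WE] := fW.
have mh : measurable_fun setT h.
  by move=> _ B mB; rewrite setTI; apply: (@Gm i); exact: Gh.
have key L E : uniq L -> (forall j, j \in L -> j \notin i :: J) ->
    (forall j, j \in L -> G j (E j)) ->
    \int[P]_w (W w * \1_(\big[setI/setT]_(j <- L) E j) w * h w) =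
    \int[P]_w W w * \prod_(j <- L) fine (P (E j)) * \int[P]_w h w.
  move=> uL LJ GE; have mE := measurable_big GE.
  have LJ' j : j \in L -> j \notin J by move=> /LJ; rewrite in_cons negb_or => /andP[].
  have iL : i \notin L by apply/negP => /LJ; rewrite mem_head.
  rewrite (@Rintegral_mul_indep _ _ _ P _ h M' M)//; first by rewrite WE.
  - by apply: measurable_funM.
  - move=> w; rewrite indicE normrM; case: (_ \in _).
      by rewrite normr1 mulr1.
    by rewrite normr0 mulr0 (le_trans _ (WM w)).
  - move=> B mB; rewrite WE//.
    pose E' j := if j == i then h @^-1` B else E j.
    have E'E j : j \in L -> E' j = E j.
      by rewrite /E'; case: eqP => // ->; rewrite (negbTE iL).
    have E'i : E' i = h @^-1` B by rewrite /E' eqxx.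
    have := WE (i :: L) E'; rewrite !big_cons E'i.
    have -> : \big[setI/setT]_(j <- L) E' j = \big[setI/setT]_(j <- L) E j.
      by rewrite big_seq [RHS]big_seq; apply: eq_bigr => j; exact: E'E.
    have -> : \prod_(j <- L) fine (P (E' j)) = \prod_(j <- L) fine (P (E j)).
      by rewrite big_seq [RHS]big_seq; apply: eq_bigr => j /E'E ->.
    rewrite [X in _ * X]mulrC mulrA => <-//.
    + apply: eq_Rintegral => w _; rewrite indicI/= -mulrA; congr (_ * _).
      by rewrite mulrC.
    + by rewrite /= iL.
    + by move=> j; rewrite in_cons => /orP[/eqP ->|/LJ'].
    + move=> j; rewrite in_cons /E'; case: (eqVneq j i) => [->|ji] /= jL.
        exact: Gh.
      exact: GE.
have E0 : \int[P]_w (W w * h w) = \int[P]_w W w * \int[P]_w h w.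
  have := key [::] (fun=> setT) isT; rewrite !big_nil mulr1 => <- //.
  by apply: eq_Rintegral => w _; rewrite indicT mulr1.
split => //; split; first exact: measurable_funM.
  by exists (M' * M) => w; rewrite normrM ler_pM.
move=> L E uL LJ GE; rewrite E0 mulrAC -key//.
by apply: eq_Rintegral => w _; rewrite mulrAC.
Qed.

End factors.

(** * Characteristic function of the jump process *)

Section jump_sum_law.
Context (R : realType) (lambda alpha : R).
Hypotheses (lambda_gt0 : 0 < lambda) (alpha_gt0 : 0 < alpha).
Context (d : measure_display) (T : measurableType d) (P : probability T R).
Variables (N : R -> {RV P >-> nat}) (X eps : nat -> {RV P >-> R}).
Hypothesis N_poisson : poisson_process lambda N.
Hypothesis X_exp : forall (j : nat) (B : set R), measurable B ->
    distribution P (X j) B = exponential_prob alpha B.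
Hypothesis eps_sign : forall j : nat,
    P [set w | eps j w = 1] = (2^-1 : R)%:E /\
    P [set w | eps j w = -1] = (2^-1 : R)%:E.
Hypothesis indep : mutually_independent P (input_sigma N X eps).
Notation mu := (@lebesgue_measure R).
Notation G := (input_sigma N X eps).

Let measurable_preimage d' (T' : measurableType d') (Y : {RV P >-> T'}) A :
  measurable A -> measurable (Y @^-1` A).
Proof.
by move=> mA; rewrite -[X in measurable X]setTI; exact: measurable_funPT.
Qed.

Let sigma_of_measurable d' (T' : measurableType d') (Y : {RV P >-> T'}) B :
  sigma_of Y B -> measurable B.
Proof. by move=> [A mA <-]; exact: measurable_funPT. Qed.

Let sigma_measurable i B : G i B -> measurable B.
Proof.
case: i => [_|[j|j]] /=; [|exact: sigma_of_measurable|exact: sigma_of_measurable].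
apply: smallest_sub; first exact: sigma_algebra_measurable.
by move=> A [t _]; exact: sigma_of_measurable.
Qed.

Let sigma_of_comp (Y : {RV P >-> R}) (phi : R -> R) (B : set R) :
  measurable_fun setT phi -> measurable B -> sigma_of Y ((fun w => phi (Y w)) @^-1` B).
Proof.
move=> mphi mB; exists (phi @^-1` B); last by rewrite setTI.
by rewrite -[X in measurable X]setTI; exact: mphi.
Qed.

(** E cos (u e^X) for X exponential with parameter alpha. *)
Definition jump_psi (u : R) : R :=
  \int[mu]_x (exponential_pdf alpha x * cos (u * expR x)).

Let mcosexp u : measurable_fun [set: R] (fun x : R => cos (u * expR x)).
Proof.
apply: (measurableT_comp (continuous_measurable_fun (@continuous_cosM R u))).
exact: measurable_expR.
Qed.

Let msinexp u : measurable_fun [set: R] (fun x : R => sin (u * expR x)).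
Proof.
apply: (measurableT_comp (continuous_measurable_fun (@continuous_sinM R u))).
exact: measurable_expR.
Qed.

Let expectation_cosX u j : \int[P]_w cos (u * expR (X j w)) = jump_psi u.
Proof.
transitivity (\int[P]_w (cst 1 w * cos (u * expR (X j w)))).
  by apply: eq_Rintegral => w _; rewrite mul1r.
apply: (@eq_weighted_law _ _ _ _ _ P mu (cst 1) (fun w => cos (u * expR (X j w)))
  (exponential_pdf alpha) (fun x => cos (u * expR x)) 1).
- exact: finite_measure_integrable_cst.
- exact: integrable_exponential_pdf.
- apply: (measurableT_comp (mcosexp u)) => //.
- exact: mcosexp.
- by move=> w; exact: cos_max.
- by move=> w; exact: cos_max.
- move=> B mB.
  pose A := (fun x : R => cos (u * expR x)) @^-1` B.
  have mA : measurable A.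
    by rewrite -[X in measurable X]setTI; exact: mcosexp.
  under eq_Rintegral do rewrite mul1r.
  rewrite Rintegral_indic; last first.
    exact: (measurable_preimage (X j) mA).
  have := X_exp j mA; rewrite /distribution /pushforward => ->.
  rewrite /exponential_prob integral_mkcond /Rintegral; congr fine.
  apply: eq_integral => x _; rewrite restrict_EFin /= patchE indicE.
  by rewrite -/A; case: ifPn => _; rewrite ?mulr1 ?mulr0.
Qed.

(** Equal to x at 1 and -1, and bounded everywhere: the signs are only almost
    surely equal to 1 or -1. *)
Let sgn_ind (x : R) : R := \1_[set 1 : R] x - \1_[set -1 : R] x.

Let msgn : measurable_fun setT sgn_ind.
Proof. by apply: measurable_funB; exact: measurable_indic. Qed.

Let sgn_le1 x : `|sgn_ind x| <= 1.
Proof.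
have E a : (x \in [set a]) = (x == a) by apply/idP/eqP; rewrite inE.
rewrite /sgn_ind !indicE !E.
by case: (x == 1); case: (x == -1); rewrite ?subrr ?subr0 ?sub0r ?normrN ?normr1 ?normr0.
Qed.

Let expectation_sgn j : \int[P]_w sgn_ind (eps j w) = 0.
Proof.
have [e1 e2] := eps_sign j.
have m1 : measurable (eps j @^-1` [set (1 : R)]) by exact: measurable_preimage.
have m2 : measurable (eps j @^-1` [set (-1 : R)]) by exact: measurable_preimage.
rewrite RintegralBT; try (apply: (@L1_bounded _ _ _ _ _ 1);
  [exact: measurable_indic|by move=> w; rewrite indicE; case: (_ \in _); rewrite ?normr1 ?normr0 ?ler01]).
rewrite -[X in X - _]/(\int[P]_w \1_(eps j @^-1` [set (1 : R)]) w) Rintegral_indic//.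
rewrite -[X in _ - X]/(\int[P]_w \1_(eps j @^-1` [set (-1 : R)]) w) Rintegral_indic//.
by rewrite [P _]e1 [P _]e2 subrr.
Qed.

Let good (w : T) := forall j, eps j w = 1 \/ eps j w = -1.

Let ae_good : {ae P, forall w, good w}.
Proof.
apply/ae_foralln => j; have [e1 e2] := eps_sign j.
have m1 : measurable [set w | eps j w = 1] by exact: (measurable_preimage (eps j) (measurable_set1 (1 : R))).
have m2 : measurable [set w | eps j w = -1] by exact: (measurable_preimage (eps j) (measurable_set1 (-1 : R))).
pose A := [set w | eps j w = 1] `|` [set w | eps j w = -1].
have mA : measurable A by exact: measurableU.
have PA : P A = 1%E.
  rewrite /A measureU//; last first.
    by rewrite -subset0 => w [/= ->]; lra.
  transitivity ((2^-1)%:E + (2^-1)%:E : \bar R)%E.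
    by congr (_ + _)%E; [exact: e1|exact: e2].
  by rewrite -EFinD; congr EFin; lra.
exists (~` A); split; first exact: measurableC.
- by have := probability_setC P mA; rewrite PA subee.
- by move=> w /= h; apply/not_orP; split => h'; apply: h; [left|right].
Qed.

(** On the event that all the signs are 1 or -1, this is [W0] times the cosine
    and the sine of u times the partial sum of the eps_j e^(X_j), by the
    addition formulas.  Each step multiplies by functions of one new variable at
    a time, as [factors_mul] requires. *)
Fixpoint jump_trig (W0 : T -> R) (u : R) (k : nat) : (T -> R) * (T -> R) :=
  if k is k'.+1 then
    let: (c, s) := jump_trig W0 u k' in
    ((fun w => c w * cos (u * expR (X k' w)) -
               s w * sin (u * expR (X k' w)) * sgn_ind (eps k' w)),
     (fun w => s w * cos (u * expR (X k' w)) +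
               c w * sin (u * expR (X k' w)) * sgn_ind (eps k' w)))
  else (W0, cst 0).

Fixpoint jump_index (k : nat) : seq (unit + (nat + nat)) :=
  if k is k'.+1 then inr (inr k') :: inr (inl k') :: jump_index k'
  else [:: inl tt].

Let jump_index_lt k j : (inr (inl j) \in jump_index k) || (inr (inr j) \in jump_index k)
  -> (j < k)%N.
Proof.
elim: k => [//|k IH]; rewrite /= !in_cons.
have H a b : (inr a == inr b :> unit + (nat + nat)) = (a == b) by [].
have Hl (a b : nat) : (inl a == inl b :> nat + nat) = (a == b) by [].
have Hr (a b : nat) : (inr a == inr b :> nat + nat) = (a == b) by [].
have Hlr (a b : nat) : (inl a == inr b :> nat + nat) = false by [].
have Hrl (a b : nat) : (inr a == inl b :> nat + nat) = false by [].
rewrite !H Hl Hr Hlr Hrl /= => /orP[/orP[/eqP->//|h]|/orP[/eqP->//|h]];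
  by apply: ltnW; apply: IH; rewrite h ?orbT.
Qed.

(** The sign has mean 0, so the cross terms vanish: the sine stays centred and
    each new jump multiplies the mean of the cosine by [jump_psi u]. *)
Lemma jump_trig_factors W0 u k : factors P G W0 [:: inl tt] ->
  [/\ factors P G (jump_trig W0 u k).1 (jump_index k),
      factors P G (jump_trig W0 u k).2 (jump_index k),
      \int[P]_w (jump_trig W0 u k).1 w = \int[P]_w W0 w * jump_psi u ^+ k &
      \int[P]_w (jump_trig W0 u k).2 w = 0].
Proof.
move=> f0; elim: k => [|k] /=.
  split => //; last by rewrite Rintegral_cst//= mul0r.
    split; first exact: measurable_cst.
      by exists 0 => w; rewrite normr0.
    move=> L E _ _ _; under eq_Rintegral do rewrite mul0r.
    by rewrite Rintegral_cst//= !mul0r.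
  by rewrite expr0 mulr1.
case: (jump_trig W0 u k) => c s /= [fc fs Ec Es].
have nX : inr (inl k) \notin jump_index k.
  by apply/negP => h; have := @jump_index_lt k k; rewrite h ltnn => /(_ isT).
have ne : inr (inr k) \notin inr (inl k) :: jump_index k.
  rewrite in_cons negb_or /=; apply/negP => h.
  by have := @jump_index_lt k k; rewrite h orbT ltnn => /(_ isT).
have mul_cos W : factors P G W (jump_index k) -> _ := fun fW =>
  factors_mul sigma_measurable fW nX (fun w => cos_max (u * expR (X k w)))
   (fun B mB => sigma_of_comp (X k) (mcosexp u) mB).
have mul_sin W : factors P G W (jump_index k) -> _ := fun fW =>
  factors_mul sigma_measurable fW nX (fun w => sin_max (u * expR (X k w)))
   (fun B mB => sigma_of_comp (X k) (msinexp u) mB).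
have mul_sgn W : factors P G W (inr (inl k) :: jump_index k) -> _ := fun fW =>
  factors_mul sigma_measurable fW ne (fun w => sgn_le1 (eps k w))
   (fun B mB => sigma_of_comp (eps k) msgn mB).
have [fcc Ecc] := mul_cos _ fc; have [fsc Esc] := mul_cos _ fs.
have [fcs Ecs] := mul_sin _ fc; have [fss Ess] := mul_sin _ fs.
have [fcsg Ecsg] := mul_sgn _ fcs; have [fssg Essg] := mul_sgn _ fss.
have {}fcc := factors_cons (inr (inr k)) fcc.
have {}fsc := factors_cons (inr (inr k)) fsc.
split.
- apply: factorsD => //; exact: factorsN.
- exact: factorsD.
- rewrite RintegralBT ?Ecc ?Essg ?expectation_sgn ?expectation_cosX ?Ec; last 2 first.
    exact: factors_L1 fcc.
    exact: factors_L1 fssg.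
  by rewrite mulr0 subr0 exprSr mulrA.
- rewrite RintegralDT ?Esc ?Ecsg ?expectation_sgn ?Es; last 2 first.
    exact: factors_L1 fsc.
    exact: factors_L1 fcsg.
  by rewrite mulr0 mul0r addr0.
Qed.

Definition jump_partial (g : R) (k : nat) (w : T) : R :=
  \sum_(0 <= j < k) eps j w * g * expR (X j w).

Let jump_trigE W0 g xi k w : good w ->
  (jump_trig W0 (xi * g) k).1 w = W0 w * cos (xi * jump_partial g k w) /\
  (jump_trig W0 (xi * g) k).2 w = W0 w * sin (xi * jump_partial g k w).
Proof.
move=> gw; elim: k => [|k /=].
  by rewrite /jump_partial big_geq// mulr0 cos0 sin0 mulr1 mulr0.
have -> : jump_partial g k.+1 w = jump_partial g k w + eps k w * g * expR (X k w).
  by rewrite /jump_partial big_nat_recr.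
case: (jump_trig W0 (xi * g) k) => c s /= [-> ->].
have E (a : R) x : \1_[set a] x = (x == a)%:R :> R.
  by rewrite indicE; congr (_%:R); congr nat_of_bool; apply/idP/eqP; rewrite inE.
have n1 : (1 == -1 :> R) = false by apply/eqP; lra.
have n2 : (-1 == 1 :> R) = false by apply/eqP; lra.
rewrite /sgn_ind !E [xi * (_ + _)]mulrDr cosD sinD.
have -> : xi * (eps k w * g * expR (X k w)) = eps k w * (xi * g * expR (X k w)) by ring.
case: (gw k) => ->; rewrite ?eqxx ?n1 ?n2 ?mul1r ?mulN1r ?cosN ?sinN /= ?mulr1n ?mulr0n; split; ring.
Qed.

Lemma measurable_jump_partial g k : measurable_fun setT (jump_partial g k).
Proof.
apply: measurable_sum => j; apply: measurable_funM.
  by apply: measurable_funM.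
by apply: measurableT_comp; first exact: measurable_expR.
Qed.

Lemma measurable_jump_sum g t : measurable_fun setT (jump_sum N X eps g t).
Proof.
move=> _ B mB; rewrite setTI.
have -> : jump_sum N X eps g t @^-1` B =
    \bigcup_n (N t @^-1` [set n] `&` jump_partial g n.+1 @^-1` B).
  apply/seteqP; split => w /=; first by move=> h; exists (N t w).
  by move=> [n _ [/= <-]].
apply: bigcupT_measurable => n; apply: measurableI.
  exact: measurable_preimage.
by rewrite -[X in measurable X]setTI; exact: measurable_jump_partial.
Qed.

Let N_ind t n w : R := \1_(N t @^-1` [set n]) w.

Let N_law t n : 0 < t -> \int[P]_w N_ind t n w = poisson_pmf (lambda * t) n.
Proof.
move=> t0; have [N0 _ _ _ Nt] := N_poisson.
pose B := [set w | N t w = (N 0 w + n)%N].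
have mB : measurable B.
  rewrite (_ : B = \bigcup_m (N 0 @^-1` [set m] `&` N t @^-1` [set (m + n)%N])).
    by apply: bigcupT_measurable => m; apply: measurableI; exact: measurable_preimage.
  apply/seteqP; split => w /=; first by rewrite /B/= => h; exists (N 0 w).
  by move=> [m _ [/= <-]].
have := Nt 0 t n (lexx _) t0; rewrite subr0 => E.
rewrite -[RHS]/(fine (poisson_pmf (lambda * t) n)%:E) -E -Rintegral_indic//.
apply: ae_eq_Rintegral.
- by apply: measurable_indic; exact: measurable_preimage.
- exact: measurable_indic.
- apply: filterS N0 => w h; rewrite /N_ind !indicE; congr (_%:R); congr nat_of_bool.
  by apply/idP/idP; rewrite !inE /B /= h add0n.
Qed.

Let N_ind_factors t n : 0 <= t -> factors P G (N_ind t n) [:: inl tt].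
Proof.
move=> t0.
have [] := @factors_mul R d T P _ G sigma_measurable (cst 1) [::] (inl tt) (N_ind t n) 1 (factors1 sigma_measurable indep) isT.
- by move=> w; rewrite /N_ind indicE; case: (_ \in _); rewrite ?normr1 ?normr0 ?ler01.
- move=> B mB /=; apply: sub_sigma_algebra; exists t => //.
  exists ((fun m => \1_[set n] m : R) @^-1` B) => //; by rewrite setTI.
move=> + _; congr (factors _ _ _ _); apply/funext => w; by rewrite mul1r.
Qed.

Let N_ind_le1 t n w : `|N_ind t n w| <= 1.
Proof.
by rewrite /N_ind indicE; case: (_ \in _); rewrite ?normr1 ?normr0 ?ler01.
Qed.

Let m_trig (f : R -> R) g xi k : continuous f ->
  measurable_fun setT (fun w => f (xi * jump_partial g k w)).
Proof.
move=> cf; apply: (measurableT_comp (continuous_measurable_fun cf)).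
by apply: measurable_funM => //; exact: measurable_jump_partial.
Qed.

(** The contribution of N(t) = n, a sum of n + 1 jumps. *)
Let slice (f : R -> R) g xi t n w : R := N_ind t n w * f (xi * jump_partial g n.+1 w).

Let slice_meas f g xi t n : continuous f -> measurable_fun setT (slice f g xi t n).
Proof.
move=> cf; apply: measurable_funM; last exact: m_trig.
by apply: measurable_indic; exact: measurable_preimage.
Qed.

Let slice_sum f g xi t m w : \sum_(n < m) slice f g xi t n w =
  (N t w < m)%N%:R * f (xi * jump_sum N X eps g t w).
Proof.
elim: m => [|m IH]; first by rewrite big_ord0 mul0r.
rewrite big_ord_recr/= IH /slice /N_ind indicE.
have -> : (w \in N t @^-1` [set m]) = (N t w == m) by apply/idP/eqP; rewrite inE.
rewrite ltnS (leq_eqVlt (N t w)); case: eqP => [E|_] /=; last by rewrite mul0r addr0.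
by rewrite E ltnn mul0r add0r /jump_partial /jump_sum E.
Qed.

Let slice_cvg (f : R -> R) g xi t : continuous f -> (forall x, `|f x| <= 1) ->
  \sum_(n < m) \int[P]_w slice f g xi t n w @[m --> \oo] -->
  \int[P]_w f (xi * jump_sum N X eps g t w).
Proof.
move=> cf f1.
have lf n : L1 P (slice f g xi t n).
  apply: (@L1_bounded _ _ _ _ _ 1); first exact: slice_meas.
  by move=> w; rewrite normrM mulr_ile1.
have ls m : L1 P (fun w => \sum_(n < m) slice f g xi t n w) /\
    \sum_(n < m) \int[P]_w slice f g xi t n w =
    \int[P]_w \sum_(n < m) slice f g xi t n w.
  elim: m => [|m [IH1 IH2]].
    have E : (fun w => \sum_(n < 0) slice f g xi t n w) = cst 0.
      by apply/funext => w; rewrite big_ord0.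
    rewrite E big_ord0 Rintegral_cst// mul0r; split => //.
    exact: finite_measure_integrable_cst.
  have E : (fun w => \sum_(n < m.+1) slice f g xi t n w) =
    (fun w => \sum_(n < m) slice f g xi t n w + slice f g xi t m w).
    by apply/funext => w; rewrite big_ord_recr.
  rewrite E big_ord_recr/= IH2; split; first exact: L1D.
  by rewrite RintegralDT.
under eq_fun do rewrite (ls _).2.
apply: (@Rintegral_cvg_dominated _ _ _ P _ _ (cst 1)).
- by move=> m; exact: L1_measurable (ls m).1.
- apply: (measurableT_comp (continuous_measurable_fun cf)).
  by apply: measurable_funM => //; exact: measurable_jump_sum.
- move=> w; apply: cvg_near_cst; near=> m; rewrite slice_sum.
  suff -> : (N t w < m)%N by rewrite mul1r.
  by near: m; exact: nbhs_infty_gt.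
- move=> m w; rewrite slice_sum normrM mulr_ile1//.
  by case: (_ < _)%N; rewrite ?normr1 ?normr0.
- exact: finite_measure_integrable_cst.
Unshelve. all: by end_near. Qed.

Let slice_trig g xi t n : 0 < t ->
  \int[P]_w slice cos g xi t n w =
    poisson_pmf (lambda * t) n * jump_psi (xi * g) ^+ n.+1 /\
  \int[P]_w slice sin g xi t n w = 0.
Proof.
move=> t0.
have [fc fs Ec Es] := jump_trig_factors (xi * g) n.+1 (N_ind_factors n (ltW t0)).
rewrite -N_law// -Ec -Es; split; apply: ae_eq_Rintegral.
- exact/slice_meas/continuous_cos.
- exact: L1_measurable (factors_L1 fc).
- apply: filterS ae_good => w gw.
  by have [->] := @jump_trigE (N_ind t n) g xi n.+1 w gw.
- exact/slice_meas/continuous_sin.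
- exact: L1_measurable (factors_L1 fs).
- apply: filterS ae_good => w gw.
  by have [_ ->] := @jump_trigE (N_ind t n) g xi n.+1 w gw.
Qed.

(** The slices N(t) = n contribute the terms of
    psi e^(- lambda t) sum_n (lambda t psi)^n / n!. *)
Theorem jump_sum_chi g xi t : 0 < t ->
  chi_cos P (jump_sum N X eps g t) xi = jump_psi (xi * g) *
    expR (- (lambda * t * (1 - jump_psi (xi * g)))) /\
  chi_sin P (jump_sum N X eps g t) xi = 0.
Proof.
move=> t0; have lt0 : 0 < lambda * t by exact: mulr_gt0.
have Cc := @slice_cvg cos g xi t (@continuous_cos R) (@cos_max R).
have Cs := @slice_cvg sin g xi t (@continuous_sin R) (@sin_max R).
split; last first.
  rewrite (_ : (fun m => _) = cst 0) in Cs.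
    exact: (cvg_unique _ Cs (cvg_cst _)).
  by apply/funext => m; rewrite big1// => n _; have [] := @slice_trig g xi t n t0.
set p := jump_psi _.
have E : (fun m => \sum_(n < m) \int[P]_w slice cos g xi t n w) =
   (fun m => p * expR (- (lambda * t)) * series (exp_coeff (lambda * t * p)) m).
  apply/funext => m; rewrite /series/= big_mkord mulr_sumr; apply: eq_bigr => n _.
  rewrite (@slice_trig g xi t n t0).1 /poisson_pmf lt0 -/p /exp_coeff/= !exprMn exprS.
  by ring.
have D : p * expR (- (lambda * t)) * series (exp_coeff (lambda * t * p)) m
    @[m --> \oo] --> p * expR (- (lambda * t)) * expR (lambda * t * p).
  apply: cvgM; first exact: cvg_cst.
  exact: is_cvg_series_exp_coeff.
rewrite E in Cc.
transitivity (p * expR (- (lambda * t)) * expR (lambda * t * p)).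
  exact: (cvg_unique _ Cc D).
by rewrite -mulrA -expRD; congr (_ * expR _); ring.
Qed.

End jump_sum_law.

(** * Second differences *)

Section second_difference.
Context (R : realType).
Implicit Types (f : R -> R) (x y z K : R).

Definition diff2 f y x := 2 * f x - f (x + y) - f (x - y).

(** Two applications of the mean value theorem, to h |-> f (x + h) + f (x - h)
    and then to f1 between x - c and x + c; this costs a factor 2 with respect
    to Taylor's formula. *)
Lemma diff2_le f f1 f2 x y K :
  (forall z, is_derive z 1 f (f1 z)) -> (forall z, is_derive z 1 f1 (f2 z)) ->
  0 < y -> (forall z, `|z - x| <= y -> `|f2 z| <= K) ->
  `|diff2 f y x| <= 2 * K * y ^+ 2.
Proof.
move=> df df1 y0 fK.
have K0 : 0 <= K by apply: le_trans (fK x _); rewrite ?normr_ge0 ?subrr ?normr0 ?ltW.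
have dc (g g' : R -> R) : (forall z, is_derive z 1 g (g' z)) -> continuous g.
  by move=> dg z; apply/differentiable_continuous/derivable1_diffP; have [] := dg z.
have d1 z : is_derive z 1 (fun h => f (x + h) + f (x - h)) (f1 (x + z) - f1 (x - z)).
  have dp : is_derive z 1 (fun h => f (x + h)) (f1 (x + z)).
    have e : is_derive z 1 (fun h : R => x + h) 1.
      by have := is_deriveD (is_derive_cst x z 1) (is_derive_id z (1 : R)); rewrite add0r.
    have := @is_derive1_comp R f (fun h => x + h) z _ _ (df (x + z)) e.
    by rewrite mulr1.
  have dm : is_derive z 1 (fun h => f (x - h)) (- f1 (x - z)).
    have e : is_derive z 1 (fun h : R => x - h) (-1).
      by have := is_deriveB (is_derive_cst x z 1) (is_derive_id z (1 : R)); rewrite sub0r.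
    have := @is_derive1_comp R f (fun h => x - h) z _ _ (df (x - z)) e.
    by rewrite mulrN1.
  exact: is_deriveD.
have [c + E] := MVT y0 (fun z _ => d1 z) (continuous_subspaceT (dc _ _ d1)).
rewrite in_itv/= => /andP[c0 cy].
have cc : x - c < x + c by rewrite ltrD2l gtrN.
have [e + E2] := MVT cc (fun z _ => df1 z) (continuous_subspaceT (dc _ _ df1)).
rewrite in_itv/= => /andP[xe ex].
have fe : `|f2 e| <= K by apply: fK; rewrite ler_norml; apply/andP; split; lra.
move: E; rewrite !subr0 addr0 E2.
rewrite (_ : diff2 f y x = - (f (x + y) + f (x - y) - (f x + f x))); last by rewrite /diff2; ring.
move=> ->; rewrite normrN !normrM (_ : x + c - (x - c) = 2 * c); last by ring.
rewrite normrM (gtr0_norm y0) (gtr0_norm c0) [`|2|]ger0_norm// (_ : 2 * K * y ^+ 2 = K * (2 * y) * y); last by ring.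
apply: ler_wpM2r; first exact: ltW.
apply: ler_pM => //; first by rewrite mulr_ge0// ltW.
by rewrite ler_pM2l// ltW.
Qed.

Lemma onem_cos_le_sqr y : `|1 - cos y| <= y ^+ 2.
Proof.
wlog y0 : y / 0 <= y.
  move=> H; have [/H//|/ltW y0] := leP 0 y.
  by have := H (- y); rewrite cosN sqrrN oppr_ge0; exact.
move: y0; rewrite le_eqVlt => /predU1P[<-|y0].
  by rewrite cos0 subrr normr0 expr0n.
have := @diff2_le cos (fun z => - sin z) (fun z => - cos z) 0 y 1.
have -> : diff2 cos y 0 = 2 * (1 - cos y).
  by rewrite /diff2 add0r sub0r cosN cos0; ring.
rewrite normrM ger0_norm// mulr1 ler_pM2l//; apply => //.
by move=> z _; rewrite normrN cos_max.
Qed.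

End second_difference.

(** * The stable constant and the weight e^(- alpha s) *)

Section riesz_kernel.
Context (R : realType) (alpha : R).
Hypotheses (alpha_gt0 : 0 < alpha) (alpha_lt2 : alpha < 2).
Notation mu := (@lebesgue_measure R).
Implicit Types (s y v c xi : R).

(** An exponential rate at which min (1, e^(2 s)) e^(- alpha s) decays at both
    ends; it is positive exactly because 0 < alpha < 2. *)
Definition riesz_rate : R := Num.min alpha (2 - alpha).
Local Notation a := riesz_rate.

Lemma riesz_rate_gt0 : 0 < a.
Proof. by rewrite /riesz_rate lt_min alpha_gt0 subr_gt0. Qed.

Lemma riesz_weight_le v s c : `|v| <= c -> `|v| <= c * expR s ^+ 2 ->
  `|v * expR (- alpha * s)| <= c * expR (- a * `|s|).
Proof.
move=> v1 v2; rewrite normrM (ger0_norm (expR_ge0 _)).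
have c0 : 0 <= c by exact: le_trans v1.
have aa : a <= alpha by rewrite /riesz_rate ge_min lexx.
have ab : a <= 2 - alpha by rewrite /riesz_rate ge_min lexx orbT.
have [s0|s0] := leP 0 s.
  rewrite ler_pM ?expR_ge0// ler_expR (ger0_norm s0) !mulNr lerN2.
  by rewrite ler_wpM2r.
apply: (@le_trans _ _ (c * expR s ^+ 2 * expR (- alpha * s))).
  by rewrite ler_wpM2r ?expR_ge0.
rewrite -mulrA ler_wpM2l// -expRM_natl -expRD ler_expR (ltr0_norm s0) mulrNN.
by rewrite -mulrDl; apply: ler_wnM2r => //; exact: ltW.
Qed.

Lemma L1_riesz_bound c : L1 mu (fun s => c * expR (- a * `|s|)).
Proof. exact/L1Z/L1_expR_abs/riesz_rate_gt0. Qed.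

(** The integrand (1 - cos y) / y^(alpha + 1) after y = e^s. *)
Definition stable_density s : R := (1 - cos (expR s)) * expR (- alpha * s).

Let meas_exp_weight (g : R -> R) : continuous g ->
  measurable_fun [set: measurableTypeR R] (fun s : R => g (expR s) * expR (- alpha * s)).
Proof.
move=> cg; apply: (@continuous_measurableT R (fun s : R => g (expR s) * expR (- alpha * s))) => s.
apply: cvgM.
  apply: (@continuous_comp _ _ _ expR g); last exact: cg.
  exact: continuous_expR.
apply: (@continuous_comp _ _ _ (fun s => - alpha * s) expR).
  by apply: cvgM; [exact: cvg_cst|].
exact: continuous_expR.
Qed.

Lemma L1_stable_density : L1 mu stable_density.
Proof.
apply: (@L1_dominated _ _ _ mu (fun s => 2 * expR (- a * `|s|))).
- apply: (@meas_exp_weight (fun y => 1 - cos y)) => y.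
  by apply: cvgB; [exact: cvg_cst|exact: continuous_cos].
- move=> s; apply: riesz_weight_le.
    by rewrite (le_trans (ler_normB _ _))// normr1 lerD2l cos_max.
  by rewrite (le_trans (onem_cos_le_sqr _))// ler_peMl ?sqr_ge0// ler1n.
- exact: L1_riesz_bound.
Qed.

Lemma stable_density_ge0 s : 0 <= stable_density s.
Proof. by rewrite mulr_ge0 ?expR_ge0// subr_ge0 cos_le1. Qed.

Let q y : R := (1 - cos y) / (`|y| `^ (alpha + 1)).

Let q_ge0 y : 0 <= q y.
Proof. by rewrite divr_ge0 ?powR_ge0// subr_ge0 cos_le1. Qed.

Let q_meas : measurable_fun [set: measurableTypeR R] (q : measurableTypeR R -> R).
Proof.
apply: measurable_funM.
  apply: (@continuous_measurableT R (fun y => 1 - cos y)) => y.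
  by apply: cvgB; [exact: cvg_cst|exact: continuous_cos].
rewrite (_ : (fun y => _) = (fun y : measurableTypeR R => `|y| `^ (- (alpha + 1)))).
  by apply: (measurableT_comp (measurable_powR _)); exact: normr_measurable.
by apply/funext => y; rewrite powRN.
Qed.

(** The substitution is made on [- n, n], where the integrand
    is continuous up to the boundary, and n tends to infinity by monotone
    convergence. *)
Let q_pos : (\int[mu]_(y in `]0%R, +oo[) (q y)%:E = (\int[mu]_s stable_density s)%:E)%E.
Proof.
have dexp : (@expR R)^`()%classic = expR.
  by apply/funext => s; rewrite derive1E derive_val.
(* (1 - cos y) / |y| ^ (alpha + 1) blows up at 0 when alpha > 1: stay away
   from 0. *)
pose I n : set R := `[expR (- n%:R), expR n%:R]%classic.
have cut n : (\int[mu]_(y in I n) (q y)%:E =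
    \int[mu]_(s in `[(- n%:R)%R, n%:R%R]) (stable_density s)%:E)%E.
  pose g y := (1 - cos y) * expR (- (alpha + 1) * ln y).
  have y0 y : I n y -> 0 < y.
    by rewrite /I/= in_itv/= => /andP[+ _]; apply: lt_le_trans; exact: expR_gt0.
  transitivity (\int[mu]_(y in I n) (g y)%:E)%E.
    apply: eq_integral => y; rewrite inE => /y0 {}y0; congr EFin.
    by rewrite /q /g gtr0_norm// /powR gt_eqF// -expRN mulNr.
  rewrite /I (@integration_by_substitution_increasing R expR g).
  - apply: eq_integral => s _; congr EFin; rewrite dexp.
    rewrite !fctE /g /= expRK /stable_density -mulrA -expRD; congr (_ * expR _); ring.
  - by apply: (@le_trans _ _ (0 : R)); rewrite ?oppr_le0 ler0n.
  - by move=> x z _ _ xz; rewrite ltr_expR.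
  - by move=> x _; rewrite dexp; exact: continuous_expR.
  - rewrite dexp; apply/cvg_ex; exists (expR (- n%:R)).
    by apply: cvg_at_right_filter; exact: continuous_expR.
  - rewrite dexp; apply/cvg_ex; exists (expR n%:R).
    by apply: cvg_at_left_filter; exact: continuous_expR.
  - split => [x _||].
    + exact: derivable_expR.
    + by apply: cvg_at_right_filter; exact: continuous_expR.
    + by apply: cvg_at_left_filter; exact: continuous_expR.
  - apply: continuous_in_subspaceT => y; rewrite inE => /y0 {}y0.
    apply: cvgM; first by apply: cvgB; [exact: cvg_cst|exact: continuous_cos].
    apply: (@continuous_comp _ _ _ (fun y => - (alpha + 1) * ln y) expR).
      by apply: cvgM; [exact: cvg_cst|exact: continuous_ln].
    exact: continuous_expR.
rewrite -EFin_Rintegral; last exact: L1_stable_density.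
have mpos : measurable_fun [set: measurableTypeR R] (fun y : measurableTypeR R => (q y)%:E).
  exact/measurable_EFinP.
have mden : measurable_fun [set: measurableTypeR R]
    (fun s : measurableTypeR R => (stable_density s)%:E).
  by have /measurable_EFinP := L1_measurable L1_stable_density.
have bnd (z : R) : exists n, `|z| <= n%:R.
  by exists (Num.bound `|z|); exact/ltW/archi_boundP.
have c1 : (\int[mu]_(y in I n) (q y)%:E @[n --> \oo] -->
    \int[mu]_(y in `]0%R, +oo[) (q y)%:E)%E.
  rewrite (_ : `]0%R, +oo[%classic = \bigcup_n I n); last first.
    apply/seteqP; split => y /=; rewrite in_itv/= andbT.
      move=> y0; have [n] := bnd (ln y); rewrite ler_norml => /andP[l1 l2].
      by exists n => //; rewrite /I/= in_itv/= -[y in X in X && _]lnK ?posrE//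
        -[y in X in _ && X]lnK ?posrE// !ler_expR l1 l2.
    by move=> [n _]; rewrite /I/= in_itv/= => /andP[+ _]; apply: lt_le_trans; exact: expR_gt0.
  apply: ge0_nondecreasing_set_cvg_integral => //.
  - apply/nondecreasing_seqP => n; rewrite subsetEset /I => y /=; rewrite !in_itv/=.
    move=> /andP[y1 y2]; apply/andP; split.
      by rewrite (le_trans _ y1)// ler_expR lerN2 ler_nat.
    by rewrite (le_trans y2)// ler_expR ler_nat.
  - by move=> n; exact: measurable_itv.
  - by move=> n; exact: (measurable_funTS mpos).
  - by move=> n x _; rewrite lee_fin.
have c2 : (\int[mu]_(s in `[(- n%:R)%R, n%:R%R]) (stable_density s)%:E @[n --> \oo] -->
    \int[mu]_s (stable_density s)%:E)%E.
  rewrite (_ : [set: R] = \bigcup_n (`[(- n%:R)%R, n%:R%R]%classic : set R)); last first.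
    apply/seteqP; split => // y _.
    by have [n] := bnd y; rewrite ler_norml => h; exists n => //=; rewrite in_itv.
  apply: ge0_nondecreasing_set_cvg_integral => //.
  - apply/nondecreasing_seqP => n; rewrite subsetEset => y /=; rewrite !in_itv/=.
    move=> /andP[y1 y2]; apply/andP; split.
      by rewrite (le_trans _ y1)// lerN2 ler_nat.
    by rewrite (le_trans y2)// ler_nat.
  - by move=> n; exact: (measurable_funTS mden).
  - by move=> n x _; rewrite lee_fin stable_density_ge0.
have E := funext cut; rewrite -E in c2.
exact: (cvg_unique _ c1 c2).
Qed.

Let q_even y : q (- y) = q y.
Proof. by rewrite /q cosN normrN. Qed.

Lemma stable_constE : stable_const alpha = \int[mu]_s stable_density s.
Proof.
have qE : (\int[mu]_y (q y)%:E = (2 * \int[mu]_s stable_density s)%:E)%E.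
  have mq : measurable_fun [set: measurableTypeR R] (fun y : measurableTypeR R => (q y)%:E).
    exact/measurable_EFinP.
  move: q_pos; move: (\int[mu]_s stable_density s) => c qc.
  rewrite -(setUv (`]0%R, +oo[%classic : set R)) ge0_integral_setU//=; last 4 first.
  - exact: measurableC.
  - by rewrite setUv.
  - by move=> y _; rewrite lee_fin.
  - exact/disj_setPCl.
  rewrite qc setCitvr.
  have -> : (\int[mu]_(y in `]-oo, 0%R]) (q y)%:E = c%:E)%E.
    rewrite -qc.
    have := @ge0_integration_by_substitution0 R (fun y => (q y)%:E) mq (fun y => q_ge0 y).
    rewrite integral_itv_obnd_cbnd; last exact: measurable_funTS.
    move=> ->; apply: eq_integral => y _; by rewrite q_even.
  by rewrite -EFinD mulr_natl mulr2n.
by rewrite /stable_const /Rintegral qE/= mulrA mulVf// mul1r.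
Qed.

(** For e^s between pi / 2 and pi the cosine is nonpositive, so the integrand is
    at least e^(- alpha s). *)
Lemma stable_const_gt0 : 0 < stable_const alpha.
Proof.
have p2 : 0 < pi / 2 :> R by rewrite divr_gt0// pi_gt0.
have pp : pi / 2 < pi :> R by rewrite ltr_pdivrMr// ltr_pMr ?pi_gt0// ltr1n.
pose A : set R := `[ln (pi / 2), ln pi]%classic.
have lnpp : ln (pi / 2) < ln pi :> R by rewrite ltr_ln ?posrE// pi_gt0.
pose c := expR (- alpha * ln pi).
have mA : measurable A by exact: measurable_itv.
have lA : L1 mu (\1_A : R -> R) by exact: integrable_indic_itv.
apply: (@lt_le_trans _ _ (\int[mu]_s (c * \1_A s))).
  rewrite RintegralZT// mulr_gt0 ?expR_gt0//.
  rewrite /Rintegral integral_indic//= setIT lebesgue_measure_itv/= lte_fin lnpp.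
  by rewrite -EFinD/= subr_gt0.
rewrite stable_constE; apply: le_RintegralT; [exact: L1Z|exact: L1_stable_density|].
move=> s; rewrite indicE; have [|_] := boolP (s \in A); last first.
  by rewrite mulr0 stable_density_ge0.
rewrite inE /A/= in_itv/= => /andP[s1 s2]; rewrite mulr1 /stable_density.
have e1 : pi / 2 <= expR s by rewrite -[leLHS]lnK ?posrE// ler_expR.
have e2 : expR s <= pi by rewrite -[leRHS]lnK ?posrE ?pi_gt0// ler_expR.
have c0 : cos (expR s) <= 0.
  have : 0 <= sin (expR s - pi / 2).
    apply: sin_ge0_pi; rewrite subr_ge0 e1/= lerBlDr (le_trans e2)// lerDl ltW//.
  by rewrite sinB cos_pihalf sin_pihalf mulr0 mulr1 sub0r oppr_ge0.
apply: (@le_trans _ _ (expR (- alpha * s))).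
  by rewrite ler_expR !mulNr lerN2 ler_wpM2l// ltW.
by rewrite ler_peMl ?expR_ge0// lerDl oppr_ge0.
Qed.

(** Multiplying e^s by |xi| is the translation of s by ln |xi|. *)
Lemma stable_density_scale xi :
  L1 mu (fun s => (1 - cos (xi * expR s)) * expR (- alpha * s)) /\
  \int[mu]_s ((1 - cos (xi * expR s)) * expR (- alpha * s)) =
    `|xi| `^ alpha * stable_const alpha.
Proof.
wlog xi0 : xi / 0 <= xi.
  move=> H; have [/H//|/ltW xi0] := leP 0 xi.
  have := H (- xi); rewrite oppr_ge0 normrN => /(_ xi0).
  by under eq_fun do rewrite mulNr cosN.
move: xi0; rewrite le_eqVlt => /predU1P[<-|xi0].
  under eq_fun do rewrite mul0r cos0 subrr mul0r.
  rewrite normr0 powR0 ?gt_eqF// mul0r Rintegral_cst//= mul0r; split => //.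
  exact: integrable0.
pose v := ln xi.
have xiE : xi = expR v by rewrite lnK// posrE.
have [l E] := L1_shift v L1_stable_density.
have F s : (1 - cos (xi * expR s)) * expR (- alpha * s) =
    xi `^ alpha * stable_density (s + v).
  rewrite /stable_density xiE -expRM mulrCA -!expRD [s + v]addrC; congr (_ * expR _).
  ring.
under eq_fun do rewrite F.
by rewrite RintegralZT// E -stable_constE gtr0_norm//; split => //; exact: L1Z.
Qed.

End riesz_kernel.

(** * The limit of the characteristic functions *)

Section jump_exponent.
Context (R : realType) (alpha : R).
Hypotheses (alpha_gt0 : 0 < alpha) (alpha_lt2 : alpha < 2).
Notation mu := (@lebesgue_measure R).
Notation psi := (jump_psi alpha).

Let lpdf : L1 mu (exponential_pdf alpha).
Proof. exact: integrable_exponential_pdf. Qed.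

Let Ipdf : \int[mu]_x exponential_pdf alpha x = 1.
Proof. by rewrite /Rintegral integral_exponential_pdf. Qed.

Let ccosexp (u : R) : continuous (fun x : R => cos (u * expR x)).
Proof.
move=> x; apply: (@continuous_comp _ _ _ expR (fun y => cos (u * y))).
  exact: continuous_expR.
exact: continuous_cosM.
Qed.

Let lpsi u : L1 mu (fun x => exponential_pdf alpha x * cos (u * expR x)).
Proof.
under eq_fun do rewrite mulrC.
apply: (@L1_mul_bounded _ _ _ mu 1 _ (fun x => cos (u * expR x))) => //.
- by apply: (@continuous_measurableT R (fun x => cos (u * expR x))); exact: ccosexp.
- by move=> x; exact: cos_max.
Qed.

Lemma jump_psi_norm u : psi `|u| = psi u.
Proof.
rewrite /jump_psi; have [u0|u0] := leP 0 u; first by rewrite ger0_norm.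
rewrite ltr0_norm//; apply: eq_Rintegral => x _.
by rewrite mulNr cosN.
Qed.

Lemma jump_psi_cvg1 (u : nat -> R) : u n @[n --> \oo] --> 0 ->
  psi (u n) @[n --> \oo] --> (1 : R).
Proof.
move=> u0; rewrite -[X in _ --> X]Ipdf /jump_psi.
apply: (@Rintegral_cvg_dominated _ _ _ mu _ _ (exponential_pdf alpha)) => //.
- by move=> n; exact: L1_measurable (lpsi _).
- exact: L1_measurable lpdf.
- move=> x; rewrite -[X in _ --> X]mulr1; apply: cvgM; first exact: cvg_cst.
  rewrite -[X in _ --> X]cos0.
  apply: (@cvg_comp _ _ _ (fun n => u n * expR x) cos _ (nbhs (0 : R))).
    by rewrite -(mul0r (expR x)); apply: cvgM => //; exact: cvg_cst.
  exact: continuous_cos.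
- move=> n x; have p0 := exponential_pdf_ge0 (ltW alpha_gt0) x.
  by rewrite normrM (ger0_norm p0) ler_piMr// cos_max.
Qed.

Let tail_int (u : R) := \int[mu]_s (\1_(`[u, +oo[ : set R) (expR s) * stable_density alpha s).

Let mind u : measurable_fun [set: measurableTypeR R]
  (fun s : measurableTypeR R => \1_(`[u, +oo[ : set R) (expR s) : R).
Proof.
apply: (@measurableT_comp _ _ _ _ _ _ (\1_(`[u, +oo[ : set R) : R -> R)).
  exact: measurable_indic.
exact: measurable_expR.
Qed.

Let indle1 (A : set R) x : `|\1_A x : R| <= 1.
Proof. by rewrite indicE; case: (_ \in _); rewrite ?normr1 ?normr0 ?ler01. Qed.

Let lJ : L1 mu (stable_density alpha).
Proof. exact: L1_stable_density. Qed.

Let ltail u : L1 mu (fun s => \1_(`[u, +oo[ : set R) (expR s) * stable_density alpha s).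
Proof.
by apply: (@L1_mul_bounded _ _ _ mu 1 _ (fun s => \1_(`[u, +oo[ : set R) (expR s))).
Qed.

(** The change of variable s = x + ln u moves the half-line of the exponential
    law to e^s >= u. *)
Lemma jump_psi_compl u : 0 < u ->
  1 - psi u = alpha * u `^ alpha * tail_int u.
Proof.
move=> u0; rewrite -Ipdf /jump_psi -RintegralBT//; pose v := ln u.
have uE : u = expR v by rewrite lnK// posrE.
have [_ E] := L1_shift v (L1Z (alpha * u `^ alpha) (ltail u)).
rewrite /tail_int -RintegralZT// -E; apply: eq_Rintegral => x _.
have -> : \1_(`[u, +oo[ : set R) (expR (x + v)) = (0 <= x)%R%:R :> R.
  by rewrite indicE mem_setE in_itv/= andbT uE ler_expR lerDr.
have [x0|x0] := leP 0 x; last first.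
  by rewrite lt0_exponential_pdf// !mul0r mulr0 subrr.
rewrite mul1r exponential_pdfE// /stable_density uE -expRM expRD mulrDr expRD.
rewrite [v * alpha]mulrC mulNr [expR (- alpha * v)](_ : _ = (expR (alpha * v))^-1); last by rewrite mulNr expRN.
rewrite [expR v * expR x]mulrC; set q := expR x * _.
have : expR (alpha * v) != 0 by rewrite gt_eqF// expR_gt0.
by move: (expR (alpha * v)) (cos q) (expR (- (alpha * x))) => p k r p0; field.
Qed.

Lemma tail_int_cvg (u : nat -> R) : u n @[n --> \oo] --> 0 ->
  tail_int (u n) @[n --> \oo] --> stable_const alpha.
Proof.
move=> u0; rewrite stable_constE// /tail_int.
apply: (@Rintegral_cvg_dominated _ _ _ mu _ _ (stable_density alpha)) => //.
- by move=> n; exact: L1_measurable (ltail _).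
- exact: L1_measurable lJ.
- move=> s; rewrite -[X in _ --> X]mul1r; apply: cvgM; last exact: cvg_cst.
  apply: cvg_near_cst; have /cvgrPdist_lt /(_ _ (expR_gt0 s)) := u0.
  apply: filterS => n; rewrite sub0r normrN => h.
  rewrite indicE mem_setE in_itv/= andbT (le_trans (ler_norm _))//.
  exact: ltW.
- move=> n s; rewrite normrM [X in _ * X]ger0_norm ?stable_density_ge0//.
  by rewrite ler_piMl ?stable_density_ge0.
Qed.

(** The factor psi, coming from the term j = 0 of the sum, tends to 1. *)
Lemma jump_exponent_cvg (lambda t xi : R) (g : nat -> R) :
  (forall n, 0 < g n) -> g n @[n --> \oo] --> 0 ->
  psi (xi * g n) * expR (- (lambda * (t / g n `^ alpha) * (1 - psi (xi * g n))))
    @[n --> \oo] -->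
  expR (- (alpha * lambda * stable_const alpha * t) * `|xi| `^ alpha).
Proof.
move=> g0 cg.
have cxi : xi * g n @[n --> \oo] --> 0.
  by rewrite -(mulr0 xi); apply: cvgM => //; exact: cvg_cst.
have cxi' : `|xi| * g n @[n --> \oo] --> 0.
  by rewrite -(mulr0 `|xi|); apply: cvgM => //; exact: cvg_cst.
rewrite -[X in _ --> X]mul1r; apply: cvgM; first exact: jump_psi_cvg1.
suff K : - (lambda * (t / g n `^ alpha) * (1 - psi (xi * g n))) @[n --> \oo] -->
    - (alpha * lambda * stable_const alpha * t) * `|xi| `^ alpha.
  exact: (@cvg_comp _ _ _ _ expR _ _ _ K (@continuous_expR R _)).
have [->|xi0] := eqVneq xi 0.
  rewrite normr0 powR0 ?gt_eqF// mulr0; apply: cvg_near_cst; apply: nearW => n.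
  have -> : psi (0 * g n) = 1.
    rewrite /jump_psi -Ipdf; apply: eq_Rintegral => x _.
    by rewrite !mul0r cos0 mulr1.
  by rewrite subrr mulr0 oppr0.
have xip : 0 < `|xi| by rewrite normr_gt0.
have E n : - (lambda * (t / g n `^ alpha) * (1 - psi (xi * g n))) =
   - (lambda * t * alpha * `|xi| `^ alpha) * tail_int (`|xi| * g n).
  rewrite -jump_psi_norm normrM (gtr0_norm (g0 n)) jump_psi_compl ?mulr_gt0//.
  rewrite powRM ?ltW//.
  have : g n `^ alpha != 0 by rewrite gt_eqF// powR_gt0.
  by move: (g n `^ alpha) (tail_int _) => p q p0; field.
under eq_fun do rewrite E.
rewrite (_ : - (_ * t) * _ = - (lambda * t * alpha * `|xi| `^ alpha) * stable_const alpha); last by ring.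
apply: cvgM; first exact: cvg_cst.
exact: tail_int_cvg.
Qed.

End jump_exponent.

Section jump_sum_limit.
Context (R : realType) (lambda alpha : R).
Hypotheses (lambda_gt0 : 0 < lambda) (alpha_gt0 : 0 < alpha) (alpha_lt2 : alpha < 2).
Context (d : measure_display) (T : measurableType d) (P : probability T R).
Variables (N : R -> {RV P >-> nat}) (X eps : nat -> {RV P >-> R}).
Hypothesis N_poisson : poisson_process lambda N.
Hypothesis X_exp : forall (j : nat) (B : set R), measurable B ->
    distribution P (X j) B = exponential_prob alpha B.
Hypothesis eps_sign : forall j : nat,
    P [set w | eps j w = 1] = (2^-1 : R)%:E /\
    P [set w | eps j w = -1] = (2^-1 : R)%:E.
Hypothesis indep : mutually_independent P (input_sigma N X eps).
Context (d' : measure_display) (T' : measurableType d') (Q : probability T' R)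
  (S : R -> {RV Q >-> R}) (S_stable : symmetric_stable_process alpha S).

Lemma stable_chi t xi : 0 <= t ->
  chi_cos Q (S t) xi = expR (- t * `|xi| `^ alpha) /\ chi_sin Q (S t) xi = 0.
Proof. by move=> t0; have [_ /(_ t xi t0) []] := S_stable. Qed.

Theorem jump_sum_cvg_in_distribution t : 0 < t ->
  cvg_in_distribution P Q (0 : R)^'+
      (fun gamma => jump_sum N X eps gamma (t / gamma `^ alpha))
      (S (alpha * lambda * stable_const alpha * t)).
Proof.
move=> t0 g cg [M gM].
set ts := alpha * lambda * stable_const alpha * t.
have ts0 : 0 <= ts.
  by rewrite ltW// mulr_gt0// mulr_gt0 ?stable_const_gt0// mulr_gt0.
have lg d0 (T0 : measurableType d0) (P0 : probability T0 R) (Z : T0 -> R) :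
    measurable_fun setT Z -> L1 P0 (fun w => g (Z w)).
  move=> mZ; apply: (@L1_bounded _ _ _ _ _ M) => //.
  exact: (measurableT_comp (continuous_measurable_fun cg) mZ).
have EE d0 (T0 : measurableType d0) (P0 : probability T0 R) (Z : T0 -> R) :
    measurable_fun setT Z ->
    ('E_P0[fun w => g (Z w)] = (\int[P0]_w g (Z w))%:E)%E.
  by move=> mZ; rewrite unlock EFin_Rintegral//; exact: lg.
rewrite EE//; apply/cvge_at_rightP => u [u0 cu].
have E n : ('E_P[fun w => g (jump_sum N X eps (u n) (t / u n `^ alpha) w)] =
    (\int[P]_w g (jump_sum N X eps (u n) (t / u n `^ alpha) w))%:E)%E.
  by apply: EE; exact: measurable_jump_sum.
under eq_fun do rewrite E.
apply: cvg_EFin; first exact: nearW.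
have s0 n : 0 < t / u n `^ alpha by rewrite divr_gt0// powR_gt0.
have chi n xi := @jump_sum_chi R lambda alpha lambda_gt0 alpha_gt0 d T P N X eps
  N_poisson X_exp eps_sign indep (u n) xi _ (s0 n).
apply: (@levy_continuity R d T P d' T' Q (fun n => jump_sum N X eps (u n) (t / u n `^ alpha))
  (S ts) _ _ _ _ g M) => //.
- by move=> n; exact: measurable_jump_sum.
- move=> xi; rewrite (stable_chi xi ts0).1.
  under eq_fun do rewrite (chi _ _).1.
  exact: jump_exponent_cvg.
- move=> xi; rewrite (stable_chi xi ts0).2.
  under eq_fun do rewrite (chi _ _).2.
  exact: cvg_cst.
Qed.

End jump_sum_limit.

(** * Transforms of smooth rapidly decreasing functions *)

Section continuity_integral.
Context (R : realType) d (T : measurableType d) (m : {measure set T -> \bar R}).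

Lemma continuous_Rintegral (f : R -> T -> R) (g : T -> R) :
  (forall x, measurable_fun setT (f x)) -> (forall s, continuous (f ^~ s)) ->
  (forall x s, `|f x s| <= g s) -> L1 m g ->
  continuous (fun x => \int[m]_s f x s).
Proof.
move=> mf cf fg lg x; apply/(@cvg_nbhsP _ R^o) => u ux.
apply: (@Rintegral_cvg_dominated _ _ _ m (fun n => f (u n)) (f x) g) => // s.
by apply: (@cvg_comp _ _ _ u (f ^~ s) _ (nbhs x)) => //; exact: cf.
Qed.

End continuity_integral.

Section smooth_decay.
Context (R : realType).
Notation mu := (@lebesgue_measure R).
Implicit Types (u f : R -> R) (x y z K : R).

Definition decay u K := forall x, `|u x| <= K * (1 + x ^+ 2)^-1.

Lemma sqr_gt0_1D x : 0 < 1 + x ^+ 2.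
Proof. by rewrite ltr_pwDl// sqr_ge0. Qed.

Lemma decay_ge0 u K : decay u K -> 0 <= K.
Proof.
by move=> /(_ 0); rewrite expr0n addr0 invr1 mulr1; apply: le_trans.
Qed.

Lemma decay_le u K x : decay u K -> `|u x| <= K.
Proof.
move=> uK; rewrite (le_trans (uK x))// ler_piMr ?(decay_ge0 uK)//.
by rewrite invf_le1 ?sqr_gt0_1D// lerDl sqr_ge0.
Qed.

Lemma decay_L1 u K : measurable_fun [set: measurableTypeR R] (u : measurableTypeR R -> R) ->
  decay u K -> L1 mu u.
Proof.
move=> meas_u uK; have [lc _] := integral_cauchy_kernel R.
exact: L1_dominated meas_u uK (L1Z K lc).
Qed.

Lemma decay_Rintegral u K : measurable_fun [set: measurableTypeR R] (u : measurableTypeR R -> R) ->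
  decay u K -> \int[mu]_x `|u x| <= K * pi.
Proof.
move=> meas_u uK; have [lc Ec] := integral_cauchy_kernel R.
rewrite -Ec -RintegralZT//; apply: le_RintegralT => //; last exact: L1Z.
exact/L1_norm/(decay_L1 meas_u uK).
Qed.

(** For |z - x| <= 1, 1 + x^2 <= 3 (1 + z^2): the bound on f2 near x is a bound
    at x. *)
Lemma diff2_decay f f1 f2 y K :
  (forall z, is_derive z 1 f (f1 z)) -> (forall z, is_derive z 1 f1 (f2 z)) ->
  0 < y <= 1 -> decay f2 K -> decay (diff2 f y) (6 * K * y ^+ 2).
Proof.
move=> df df1 /andP[y0 y1] f2K x; have K0 := decay_ge0 f2K.
rewrite (_ : 6 * K * y ^+ 2 * _ = 2 * (3 * K * (1 + x ^+ 2)^-1) * y ^+ 2); last by ring.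
apply: (diff2_le df df1 y0) => z zx; apply: (le_trans (f2K z)).
have zx1 : (z - x) ^+ 2 <= 1.
  by rewrite -real_normK ?num_real// expr_le1// (le_trans zx).
have h : 1 + x ^+ 2 <= 3 * (1 + z ^+ 2).
  have := sqr_ge0 (2 * z - x); have := sqr_ge0 z.
  rewrite (_ : (2 * z - x) ^+ 2 = 2 * z ^+ 2 + 2 * (z - x) ^+ 2 - x ^+ 2); last by ring.
  lra.
rewrite -mulrA mulrCA ler_wpM2l// -[leLHS]mul1r ler_pdivrMr ?sqr_gt0_1D//.
by rewrite mulrAC ler_pdivlMr ?sqr_gt0_1D// mul1r.
Qed.

End smooth_decay.

Section trig_transform.
Context (R : realType).
Notation mu := (@lebesgue_measure R).
Implicit Types (u f : R -> R) (x y z K xi : R).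
(** [e] stands for the cosine and for the sine: the addition rule [esum] is all
    that distinguishes them from other bounded continuous functions here. *)
Variable e : R -> R.
Hypotheses (ce : continuous e) (e1 : forall p, `|e p| <= 1).
Hypothesis esum : forall p q, e (p - q) + e (p + q) = 2 * (e p * cos q).

Definition trig_transform u xi := \int[mu]_x (e (xi * x) * u x).

Let ceM xi : continuous (fun x => e (xi * x)).
Proof.
move=> x; apply: (@continuous_comp _ _ _ (fun x => xi * x) e); last exact: ce.
by apply: cvgM; [exact: cvg_cst|].
Qed.

Let L1_eM xi u : L1 mu u -> L1 mu (fun x => e (xi * x) * u x).
Proof.
move=> lu; apply: (@L1_mul_bounded _ _ _ mu 1 u (fun x => e (xi * x))) => //.
by apply: continuous_measurableT; exact: ceM.
Qed.

Lemma trig_transform_le u xi : L1 mu u -> `|trig_transform u xi| <= \int[mu]_x `|u x|.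
Proof.
move=> lu; apply: norm_Rintegral_le; [exact: L1_eM|exact: L1_norm|].
by move=> x; rewrite normrM ler_piMl.
Qed.

Lemma continuous_trig_transform u : L1 mu u -> continuous (trig_transform u).
Proof.
move=> lu.
apply: (@continuous_Rintegral R _ _ mu (fun xi x => e (xi * x) * u x) (fun x => `|u x|)).
- by move=> xi; exact: L1_measurable (L1_eM xi lu).
- move=> x xi; apply: cvgM; last exact: cvg_cst.
  apply: (@continuous_comp _ _ _ (fun xi => xi * x) e); last exact: ce.
  by apply: cvgM; last exact: cvg_cst.
- by move=> xi x; rewrite normrM ler_piMl.
- exact: L1_norm.
Qed.

Lemma L1_diff2 u y : L1 mu u -> L1 mu (diff2 u y) /\
  \int[mu]_x `|diff2 u y x| <= 4 * \int[mu]_x `|u x|.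
Proof.
move=> lu; have ln := L1_norm lu.
have [lp _] := L1_shift y lu; have [lm _] := L1_shift (- y) lu.
have [lpn Ep] := L1_shift y ln; have [lmn Em] := L1_shift (- y) ln.
have ld : L1 mu (diff2 u y) by apply: L1B; [apply: L1B => //; exact: L1Z|].
split => //.
rewrite (_ : 4 * _ = 2 * \int[mu]_x `|u x| + \int[mu]_x `|u x| + \int[mu]_x `|u x|); last by ring.
rewrite -[X in _ <= _ + X + _]Ep -[X in _ <= _ + X]Em.
rewrite -RintegralZT// -RintegralDT//; last exact: L1Z.
rewrite -RintegralDT//; last by apply: L1D => //; exact: L1Z.
apply: le_RintegralT; first exact: L1_norm.
  by apply: L1D => //; apply: L1D => //; exact: L1Z.
move=> x; rewrite /diff2 (le_trans (ler_normB _ _))// lerD// (le_trans (ler_normB _ _))// lerD//.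
by rewrite normrM normr_nat.
Qed.

(** Translations of u are moved to the trigonometric factor. *)
Lemma trig_transform_diff2 u y xi : L1 mu u ->
  trig_transform (diff2 u y) xi = (2 - 2 * cos (xi * y)) * trig_transform u xi.
Proof.
move=> lu.
have [lp _] := L1_shift y lu; have [lm _] := L1_shift (- y) lu.
have shift c : L1 mu (fun x => e (xi * x) * u (x + c)) /\
    \int[mu]_x (e (xi * x) * u (x + c)) = \int[mu]_x (e (xi * x - xi * c) * u x).
  pose g x := e (xi * x - xi * c) * u x.
  have lg : L1 mu g.
    apply: (@L1_mul_bounded _ _ _ mu 1 u (fun x => e (xi * x - xi * c))) => //.
    apply: continuous_measurableT => x.
    apply: (@continuous_comp _ _ _ (fun x => xi * x - xi * c) e); last exact: ce.
    by apply: cvgB; [apply: cvgM; [exact: cvg_cst|]|exact: cvg_cst].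
  have [l E] := L1_shift c lg.
  have gE x : g (x + c) = e (xi * x) * u (x + c).
    by rewrite /g mulrDr addrK.
  by move: l E; under eq_fun do rewrite gE.
have [lp1 Ep1] := shift y; have [lm1 Em1] := shift (- y).
have le_ := L1_eM xi lu.
transitivity (\int[mu]_x (2 * (e (xi * x) * u x) - e (xi * x) * u (x + y)
    - e (xi * x) * u (x - y))).
  by apply: eq_Rintegral => x _; rewrite /diff2; ring.
rewrite RintegralBT//; last by apply: L1B => //; exact: L1Z.
rewrite RintegralBT//; last exact: L1Z.
rewrite RintegralZT// Ep1 Em1 mulrBl -addrA -opprD -/(trig_transform u xi).
congr (_ - _).
have lq c : L1 mu (fun x => e (xi * x - xi * c) * u x).
  apply: (@L1_mul_bounded _ _ _ mu 1 u (fun x => e (xi * x - xi * c))) => //.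
  apply: continuous_measurableT => x.
  apply: (@continuous_comp _ _ _ (fun x => xi * x - xi * c) e); last exact: ce.
  by apply: cvgB; [apply: cvgM; [exact: cvg_cst|]|exact: cvg_cst].
rewrite -RintegralDT// /trig_transform -RintegralZT//.
apply: eq_Rintegral => x _.
rewrite -mulrDl mulrN opprK esum; ring.
Qed.

(** For |xi| > pi take y = pi / |xi| <= 1: then cos (xi y) = -1, so a fourth
    difference with step y multiplies the transform by 16 while its L1 norm
    is O(y^4).  This gives the decay |xi|^-4 without integration by parts. *)
Lemma trig_transform_decay (u : nat -> R -> R) K0 K4 :
  (forall n z, is_derive z 1 (u n) (u n.+1 z)) -> decay (u 0%N) K0 ->
  decay (u 4%N) K4 ->
  exists B, forall xi, (1 + xi ^+ 2) * `|trig_transform (u 0%N) xi| <= B * (1 + xi ^+ 2)^-1.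
Proof.
move=> du u0K u4K.
have cu n : continuous (u n).
  by move=> z; apply/differentiable_continuous/derivable1_diffP; have [] := du n z.
have lu0 : L1 mu (u 0%N) by apply: decay_L1 u0K; apply: continuous_measurableT; exact: cu.
have K40 := decay_ge0 u4K.
pose I0 := \int[mu]_x `|u 0%N x|.
have I00 : 0 <= I0 by apply: Rintegral_ge0 => x _.
have pi0 : 0 < pi :> R := pi_gt0 R.
(* 36 = 6 * 6 and the last pi come from two second differences of a function
   bounded by K4 / (1 + x^2); 16 = (2 - 2 cos pi)^2. *)
pose D := 36 * K4 * pi ^+ 4 * pi / 16.
have pi0' := ltW pi0.
have D0 : 0 <= D.
  by rewrite divr_ge0// mulr_ge0// mulr_ge0 ?exprn_ge0// mulr_ge0.
exists ((1 + pi ^+ 2) ^+ 2 * I0 + 4 * D) => xi.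
have x2 := sqr_gt0_1D xi.
rewrite ler_pdivlMr//; have [xipi|xipi] := leP `|xi| pi.
  apply: (@le_trans _ _ ((1 + pi ^+ 2) ^+ 2 * I0)); last by rewrite lerDl mulr_ge0.
  have xp : 1 + xi ^+ 2 <= 1 + pi ^+ 2.
    by rewrite lerD2l -real_normK ?num_real// lerXn2r// nnegrE ltW.
  rewrite mulrAC expr2 ler_pM//.
  - by rewrite mulr_ge0// ltW.
  - by rewrite ler_pM// ltW.
  - exact: trig_transform_le.
have xi0 : 0 < `|xi| by exact: lt_trans xipi.
pose y := pi / `|xi|.
have y0 : 0 < y by rewrite divr_gt0.
have y1 : y <= 1 by rewrite ler_pdivrMr// mul1r ltW.
have cosy : cos (xi * y) = -1.
  rewrite /y; have [x0|x0] := leP 0 xi.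
    by rewrite ger0_norm// mulrC divfK ?cospi// -normr_gt0.
  by rewrite ltr0_norm// invrN mulrN mulrN mulrCA divff ?lt_eqF// mulr1 cosN cospi.
have l1 := (L1_diff2 y lu0).1.
have l2 := (L1_diff2 y l1).1.
have E16 : trig_transform (diff2 (diff2 (u 0%N) y) y) xi = 16 * trig_transform (u 0%N) xi.
  by rewrite !trig_transform_diff2// cosy; ring.
have y01 : 0 < y <= 1 by rewrite y0 y1.
have dd n z : is_derive z 1 (diff2 (u n) y) (diff2 (u n.+1) y z).
  have ds c : is_derive z 1 (fun x => u n (x + c)) (u n.+1 (z + c)).
    have es : is_derive z 1 (fun h : R => h + c) 1.
      by have := is_deriveD (is_derive_id z (1 : R)) (is_derive_cst c z 1); rewrite addr0.
    have := @is_derive1_comp R (u n) (fun h => h + c) z _ _ (du n (z + c)) es.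
    by rewrite mulr1.
  exact: is_deriveB (is_deriveB (is_deriveZ 2 (du n z)) (ds y)) (ds (- y)).
have d2 := diff2_decay (du 2%N) (du 3%N) y01 u4K.
have d4 := diff2_decay (dd 0%N) (dd 1%N) y01 d2.
have := trig_transform_le xi l2; rewrite E16.
move=> /le_trans /(_ (decay_Rintegral (L1_measurable l2) d4)).
rewrite normrM ger0_norm// => H.
have {}H : `|trig_transform (u 0%N) xi| <= D / `|xi| ^+ 4.
  rewrite -(ler_pM2l (_ : 0 < 16 :> R))// (le_trans H)// le_eqVlt; apply/orP; left.
  have xn0 : `|xi| != 0 by rewrite gt_eqF.
  by rewrite /D /y; move: (pi : R) xn0 => p xn0; apply/eqP; field.
have xi1 : 1 <= xi ^+ 2.
  rewrite -real_normK ?num_real// -[leLHS](expr1n _ 2) lerXn2r ?nnegrE//.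
  apply: (le_trans _ (ltW xipi)); have := @pi_ge2 R; lra.
rewrite mulrAC -expr2.
apply: (@le_trans _ _ ((2 * xi ^+ 2) ^+ 2 * (D / `|xi| ^+ 4))).
  apply: ler_pM; [exact: sqr_ge0|exact: normr_ge0| |exact: H].
  have h2 : 1 + xi ^+ 2 <= 2 * xi ^+ 2 by rewrite mulr_natl mulr2n lerD2r.
  by rewrite lerXn2r// nnegrE; [exact: ltW|exact: le_trans (ltW x2) h2].
have xn0 : `|xi| != 0 by rewrite gt_eqF.
have -> : (2 * xi ^+ 2) ^+ 2 * (D / `|xi| ^+ 4) = 4 * D.
  rewrite -(real_normK (num_real xi)); by move: (`|xi|) xn0 => r r0; field.
by rewrite lerDr mulr_ge0// exprn_ge0// addr_ge0// sqr_ge0.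
Qed.

End trig_transform.

(** * The Riesz operator as a singular integral *)

Section riesz_real.
Context (R : realType) (alpha : R).
Hypotheses (alpha_gt0 : 0 < alpha) (alpha_lt2 : alpha < 2).
Notation mu := (@lebesgue_measure R).
Notation C := (stable_const alpha).
Notation a := (riesz_rate alpha).

(** The singular integral of second differences, with step e^s. *)
Definition riesz (u : R -> R) (x : R) : R :=
  (2 * C)^-1 * \int[mu]_s (diff2 u (expR s) x * expR (- alpha * s)).

Variables (u u1 u2 : R -> R) (K0 K2 : R).
Hypotheses (du : forall z : R, is_derive z (1 : R) u (u1 z))
  (du1 : forall z : R, is_derive z (1 : R) u1 (u2 z)).
Hypotheses (uK : decay u K0) (u2K : decay u2 K2).

Let cu : continuous u.
Proof.
by move=> z; apply/differentiable_continuous/derivable1_diffP; have [] := du z.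
Qed.

Let meas_u : measurable_fun [set: measurableTypeR R] (u : measurableTypeR R -> R).
Proof. exact: continuous_measurableT cu. Qed.

Let lu : L1 mu u.
Proof. exact: decay_L1 meas_u uK. Qed.

Let K00 : 0 <= K0 := decay_ge0 uK.
Let K20 : 0 <= K2 := decay_ge0 u2K.

Let expR_sqr_le1 (s : R) : s <= 0 -> 0 < expR s <= 1.
Proof. by move=> s0; rewrite expR_gt0 -[leRHS]expR0 ler_expR. Qed.

Let expR_sqr_ge1 (s : R) : 0 <= s -> 1 <= expR s ^+ 2.
Proof. by move=> s0; rewrite -expRM_natl -[leLHS]expR0 ler_expR mulr_ge0. Qed.

(** Small steps are controlled by the second derivative, large ones by the
    function itself; c1 works for both, pointwise in x, and c2 below after
    integration over x. *)
Let c1 := 4 * K0 + 6 * K2.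

Lemma riesz_integrand_le x s :
  `|diff2 u (expR s) x * expR (- alpha * s)| <= c1 * expR (- a * `|s|).
Proof.
have b4 : `|diff2 u (expR s) x| <= 4 * K0.
  have h z : `|u z| <= K0 := decay_le z uK.
  rewrite /diff2 (_ : 4 * K0 = 2 * K0 + K0 + K0); last by ring.
  rewrite (le_trans (ler_normB _ _))// lerD// (le_trans (ler_normB _ _))// lerD//.
  by rewrite normrM normr_nat ler_pM2l.
have c10 : 0 <= c1 by rewrite addr_ge0// mulr_ge0.
apply: riesz_weight_le => //.
  by rewrite (le_trans b4)// lerDl mulr_ge0.
have [s0|s0] := leP s 0.
  have := diff2_decay du du1 (expR_sqr_le1 s0) u2K x.
  move=> /le_trans; apply; apply: (@le_trans _ _ (6 * K2 * expR s ^+ 2)).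
    rewrite ler_piMr//; first by rewrite mulr_ge0 ?sqr_ge0// mulr_ge0.
    by rewrite invf_le1 ?sqr_gt0_1D// lerDl sqr_ge0.
  by rewrite ler_wpM2r ?sqr_ge0// lerDr mulr_ge0.
apply: (@le_trans _ _ c1); first by rewrite (le_trans b4)// lerDl mulr_ge0.
by rewrite ler_peMr// expR_sqr_ge1// ltW.
Qed.

Let c2 := 4 * \int[mu]_x `|u x| + 6 * K2 * pi.

Let integrand_x_le s : \int[mu]_x `|diff2 u (expR s) x * expR (- alpha * s)|
   <= c2 * expR (- a * `|s|).
Proof.
have [ld b4] := L1_diff2 (expR s) lu.
have I0 : 0 <= \int[mu]_x `|u x| by apply: Rintegral_ge0 => x _.
have pi0 : 0 <= pi :> R := ltW (pi_gt0 R).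
have D0 : 0 <= \int[mu]_x `|diff2 u (expR s) x| by apply: Rintegral_ge0 => x _.
have c20 : 0 <= c2 by rewrite addr_ge0 ?mulr_ge0.
have -> : \int[mu]_x `|diff2 u (expR s) x * expR (- alpha * s)| =
   `|\int[mu]_x `|diff2 u (expR s) x| * expR (- alpha * s)|.
  rewrite [RHS]ger0_norm ?mulr_ge0 ?expR_ge0// [RHS]mulrC -RintegralZT; last exact: L1_norm.
  by apply: eq_Rintegral => x _; rewrite normrM mulrC ger0_norm// expR_ge0.
apply: riesz_weight_le => //; rewrite ger0_norm//.
  by rewrite (le_trans b4)// lerDl !mulr_ge0.
have [s0|s0] := leP s 0.
  have := decay_Rintegral (L1_measurable ld) (diff2_decay du du1 (expR_sqr_le1 s0) u2K).
  move=> /le_trans; apply; rewrite -mulrA [_ ^+ 2 * _]mulrC mulrA ler_wpM2r ?sqr_ge0//.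
  by rewrite lerDr mulr_ge0.
apply: (@le_trans _ _ c2); first by rewrite (le_trans b4)// lerDl !mulr_ge0.
by rewrite ler_peMr// expR_sqr_ge1// ltW.
Qed.

Let meas_x s : measurable_fun [set: measurableTypeR R]
  (fun x : measurableTypeR R => diff2 u (expR s) x * expR (- alpha * s)).
Proof.
apply: measurable_funM; last exact: measurable_cst.
exact: L1_measurable (L1_diff2 (expR s) lu).1.
Qed.

Let meas_xs : measurable_fun setT (fun z : measurableTypeR R * measurableTypeR R =>
  diff2 u (expR z.2) z.1 * expR (- alpha * z.2)).
Proof.
have m2 : measurable_fun setT (fun z : measurableTypeR R * measurableTypeR R => expR z.2 : R).
  by apply: measurableT_comp; [exact: measurable_expR|exact: measurable_snd].
apply: measurable_funM.
  apply: measurable_funB; first apply: measurable_funB.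
  - apply: measurable_funM; first exact: measurable_cst.
    by apply: (measurableT_comp meas_u); exact: measurable_fst.
  - apply: (measurableT_comp meas_u); apply: measurable_funD => //; exact: measurable_fst.
  - apply: (measurableT_comp meas_u); apply: measurable_funB => //; exact: measurable_fst.
apply: measurableT_comp; first exact: measurable_expR.
by apply: measurable_funM; [exact: measurable_cst|exact: measurable_snd].
Qed.

Let meas_s x : measurable_fun [set: measurableTypeR R]
  (fun s : measurableTypeR R => diff2 u (expR s) x * expR (- alpha * s)).
Proof.
have cs (c : R) : continuous (fun s : R => u (x + c * expR s)).
  move=> s; apply: (@continuous_comp _ _ _ (fun s => x + c * expR s) u); last exact: cu.
  apply: cvgD; first exact: cvg_cst.
  by apply: cvgM; [exact: cvg_cst|exact: continuous_expR].
apply: measurable_funM; last first.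
  apply: measurableT_comp; first exact: measurable_expR.
  by apply: measurable_funM; first exact: measurable_cst.
apply: measurable_funB; first apply: measurable_funB.
- exact: measurable_cst.
- have := continuous_measurableT (cs 1); by under eq_fun do rewrite mul1r.
- have := continuous_measurableT (cs (-1)); by under eq_fun do rewrite mulN1r.
Qed.

Let bound_L1 c : L1 mu (fun s => c * expR (- a * `|s|)).
Proof. exact: L1_riesz_bound. Qed.

Lemma L1_riesz_integrand x : L1 mu (fun s => diff2 u (expR s) x * expR (- alpha * s)).
Proof.
apply: L1_dominated (bound_L1 c1); first exact: meas_s.
exact: riesz_integrand_le.
Qed.

Let L1_x s : L1 mu (fun x => diff2 u (expR s) x * expR (- alpha * s)).
Proof.
by under eq_fun do rewrite mulrC; apply: L1Z; exact: (L1_diff2 (expR s) lu).1.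
Qed.

Lemma continuous_riesz : continuous (riesz u).
Proof.
move=> x; apply: cvgM; first exact: cvg_cst.
apply: (@continuous_Rintegral R _ _ mu
  (fun x s => diff2 u (expR s) x * expR (- alpha * s))
  (fun s => c1 * expR (- a * `|s|))) => //; last exact: riesz_integrand_le.
move=> s y; apply: cvgM; last exact: cvg_cst.
have cs (c : R) : {for y, continuous (fun y : R => u (y + c))}.
  apply: (@continuous_comp _ _ _ (fun y => y + c) u); last exact: cu.
  by apply: cvgD; last exact: cvg_cst.
apply: cvgB; last exact: cs.
apply: cvgB; last exact: cs.
by apply: cvgM; [exact: cvg_cst|exact: cu].
Qed.

Lemma riesz_bounded : exists M, forall x, `|riesz u x| <= M.
Proof.
exists (`|(2 * C)^-1| * \int[mu]_s (c1 * expR (- a * `|s|))) => x.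
rewrite normrM ler_wpM2l//; apply: norm_Rintegral_le => //.
- exact: L1_riesz_integrand.
- exact: riesz_integrand_le.
Qed.

Lemma L1_riesz : L1 mu (riesz u).
Proof.
apply: L1Z.
by have [] := @Rintegral_swap _ _ _ _ R mu mu
  (fun x s => diff2 u (expR s) x * expR (- alpha * s)) _ meas_xs
  L1_riesz_integrand L1_x integrand_x_le (bound_L1 c2).
Qed.

(** The transform of the second difference with step e^s carries the factor
    2 (1 - cos (xi e^s)), and integrating over s gives 2 |xi|^alpha C. *)
Lemma trig_transform_riesz (e : R -> R) xi : continuous e -> (forall p, `|e p| <= 1) ->
  (forall p q, e (p - q) + e (p + q) = 2 * (e p * cos q)) ->
  trig_transform e (riesz u) xi = `|xi| `^ alpha * trig_transform e u xi.
Proof.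
move=> ce e1 esum.
pose f x s := e (xi * x) * (diff2 u (expR s) x * expR (- alpha * s)).
have cex : continuous (fun x => e (xi * x)).
  move=> x; apply: (@continuous_comp _ _ _ (fun x => xi * x) e); last exact: ce.
  by apply: cvgM; [exact: cvg_cst|].
have mex : measurable_fun [set: measurableTypeR R] (fun x : measurableTypeR R => e (xi * x)).
  exact: (continuous_measurableT cex).
have mf : measurable_fun setT (fun z : measurableTypeR R * measurableTypeR R => f z.1 z.2).
  apply: measurable_funM; last exact: meas_xs.
  by apply: (measurableT_comp mex); exact: measurable_fst.
have f2 x : L1 mu (f x) by exact/L1Z/L1_riesz_integrand.
have f1 s : L1 mu (f ^~ s) by apply: L1_mul_bounded (L1_x s).
have fB s : \int[mu]_x `|f x s| <= c2 * expR (- a * `|s|).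
  apply: le_trans (integrand_x_le s); apply: le_RintegralT; try exact: L1_norm.
  by move=> x; rewrite normrM ler_piMl.
have [_ _ E] := @Rintegral_swap _ _ _ _ R mu mu f _ mf f2 f1 fB (bound_L1 c2).
transitivity ((2 * C)^-1 * \int[mu]_x \int[mu]_s f x s).
  rewrite /trig_transform -RintegralZT; last first.
    by have [] := @Rintegral_swap _ _ _ _ R mu mu f _ mf f2 f1 fB (bound_L1 c2).
  apply: eq_Rintegral => x _; rewrite /f RintegralZT; last exact: L1_riesz_integrand.
  by rewrite /riesz mulrCA.
have [ls Es] := stable_density_scale alpha_gt0 alpha_lt2 xi.
have /lt0r_neq0 C0 := stable_const_gt0 alpha_gt0 alpha_lt2.
rewrite E; transitivity ((2 * C)^-1 * \int[mu]_s
    (2 * trig_transform e u xi * ((1 - cos (xi * expR s)) * expR (- alpha * s)))).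
  congr (_ * _); apply: eq_Rintegral => s _; rewrite /f.
  transitivity (expR (- alpha * s) * trig_transform e (diff2 u (expR s)) xi).
    rewrite /trig_transform -RintegralZT; last first.
      exact: L1_mul_bounded mex _ (L1_diff2 (expR s) lu).1.
    by apply: eq_Rintegral => x _; ring.
  rewrite (trig_transform_diff2 ce e1 esum (expR s) xi lu).
  by move: (trig_transform e u xi) (expR (- alpha * s)) (cos (xi * expR s)) => p q r; ring.
rewrite (RintegralZT _ ls) Es.
by move: (trig_transform e u xi) (`|xi| `^ alpha) (C) C0 => t p c n0; field.
Qed.

End riesz_real.

Section schwartz_real.
Context (R : realType).
Notation mu := (@lebesgue_measure R).
Implicit Types (u : R -> R) (x z xi : R).

Lemma schwartz_jet u n z : real_schwartz u ->
  is_derive z (1 : R) (derive1n n u) (derive1n n.+1 u z).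
Proof.
move=> [du _]; rewrite derive1nS derive1E; exact/derivableP/du.
Qed.

Lemma schwartz_decay u n : real_schwartz u -> exists K, decay (derive1n n u) K.
Proof.
move=> [_ bu]; have [M0 hM0] := bu 0%N n; have [M2 hM2] := bu 2%N n.
exists (M0 + M2) => x; rewrite ler_pdivlMr ?sqr_gt0_1D// mulrDr mulr1 lerD//.
  by have := hM0 x; rewrite expr0 mul1r.
by have := hM2 x; rewrite mulrC real_normK ?num_real.
Qed.

Lemma cos_addB (p q : R) : cos (p - q) + cos (p + q) = 2 * (cos p * cos q).
Proof. by rewrite cosB cosD; ring. Qed.

Lemma sin_addB (p q : R) : sin (p - q) + sin (p + q) = 2 * (sin p * cos q).
Proof. by rewrite sinB sinD; ring. Qed.

Variable alpha : R.
Hypotheses (alpha_gt0 : 0 < alpha) (alpha_lt2 : alpha < 2).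

Lemma powR_le_1Dsqr xi : `|xi| `^ alpha <= 1 + xi ^+ 2.
Proof.
rewrite -(real_normK (num_real xi)); move: (`|xi|) (normr_ge0 xi) => r r0.
have [r1|r1] := leP r 1.
  apply: (@le_trans _ _ 1); last by rewrite lerDl sqr_ge0.
  apply: (@le_trans _ _ (1 `^ alpha)); last by rewrite powR1.
  by rewrite ge0_ler_powR// ?nnegrE// ltW.
apply: (@le_trans _ _ (r `^ 2)).
  by rewrite ler_powR// ltW.
by rewrite powR_mulrn// lerDr.
Qed.

Lemma continuous_schwartz u : real_schwartz u -> continuous u.
Proof.
move=> su z; apply/differentiable_continuous/derivable1_diffP.
by have [] := schwartz_jet 0 z su.
Qed.

Lemma L1_schwartz u : real_schwartz u -> L1 mu u.
Proof.
move=> su; have [K uK] := schwartz_decay 0 su.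
apply: decay_L1 uK; apply: (@continuous_measurableT R u); exact: continuous_schwartz.
Qed.

Lemma L1_powR_trig (e : R -> R) u : continuous e -> (forall p, `|e p| <= 1) ->
  (forall p q, e (p - q) + e (p + q) = 2 * (e p * cos q)) -> real_schwartz u ->
  L1 mu (fun xi => `|xi| `^ alpha * trig_transform e u xi).
Proof.
move=> ce e1 esum su.
have [K0 uK0] := schwartz_decay 0 su; have [K4 uK4] := schwartz_decay 4 su.
have [B hB] := @trig_transform_decay R e ce e1 esum (fun n => derive1n n u) K0 K4
  (fun n z => schwartz_jet n z su) uK0 uK4.
apply: (@decay_L1 R _ B).
  apply: measurable_funM.
    by apply: (measurableT_comp (measurable_powR alpha)); exact: normr_measurable.
  apply: (@continuous_measurableT R (trig_transform e u)).
  by apply: continuous_trig_transform => //; exact: L1_schwartz.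
move=> xi; apply: le_trans (hB xi).
by rewrite normrM ger0_norm ?powR_ge0// ler_wpM2r// powR_le_1Dsqr.
Qed.

Lemma riesz_schwartz u : real_schwartz u ->
  [/\ continuous (riesz alpha u), L1 mu (riesz alpha u),
   (forall xi, cos_transform (riesz alpha u) xi = `|xi| `^ alpha * cos_transform u xi),
   (forall xi, sin_transform (riesz alpha u) xi = `|xi| `^ alpha * sin_transform u xi) &
   forall x, \int[mu]_xi (cos (xi * x) * (`|xi| `^ alpha * cos_transform u xi) +
      sin (xi * x) * (`|xi| `^ alpha * sin_transform u xi)) = 2 * pi * riesz alpha u x].
Proof.
move=> su; have d0 z := schwartz_jet 0 z su; have d1 z := schwartz_jet 1 z su.
have [K0 uK0] := schwartz_decay 0 su; have [K2 uK2] := schwartz_decay 2 su.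
have cr := continuous_riesz alpha_gt0 alpha_lt2 d0 d1 uK0 uK2.
have lr := L1_riesz alpha_gt0 alpha_lt2 d0 d1 uK0 uK2.
have [M rM] := riesz_bounded alpha_gt0 alpha_lt2 d0 d1 uK0 uK2.
have Ec xi : cos_transform (riesz alpha u) xi = `|xi| `^ alpha * cos_transform u xi.
  exact: (trig_transform_riesz alpha_gt0 alpha_lt2 d0 d1 uK0 uK2 xi (@continuous_cos R) (@cos_max R) cos_addB).
have Es xi : sin_transform (riesz alpha u) xi = `|xi| `^ alpha * sin_transform u xi.
  exact: (trig_transform_riesz alpha_gt0 alpha_lt2 d0 d1 uK0 uK2 xi (@continuous_sin R) (@sin_max R) sin_addB).
split => // x; rewrite -(@fourier_inversion R _ M x cr rM lr).
- by apply: eq_Rintegral => xi _; rewrite Ec Es.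
- rewrite (funext Ec); exact: (L1_powR_trig (@continuous_cos R) (@cos_max R) cos_addB su).
- rewrite (funext Es); exact: (L1_powR_trig (@continuous_sin R) (@sin_max R) sin_addB su).
Qed.

Lemma cos_transformN u xi : cos_transform u (- xi) = cos_transform u xi.
Proof. by apply: eq_Rintegral => x _; rewrite mulNr cosN. Qed.

Lemma sin_transformN u xi : real_schwartz u ->
  sin_transform u (- xi) = - sin_transform u xi.
Proof.
move=> su; rewrite /sin_transform -RintegralNT; last exact/L1_sinM/L1_schwartz.
by apply: eq_Rintegral => x _; rewrite mulNr sinN mulNr.
Qed.

End schwartz_real.

(** * The generator *)

Section complex_fourier.
Context (R : realType).
Notation mu := (@lebesgue_measure R).
Implicit Types (f : R -> R[i]) (x xi : R).

Lemma fourierE f xi : L1 mu (fun x => complex.Re (f x)) ->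
  L1 mu (fun x => complex.Im (f x)) ->
  fourier f xi =
  ((cos_transform (fun x => complex.Re (f x)) xi -
    sin_transform (fun x => complex.Im (f x)) xi) +i*
   (sin_transform (fun x => complex.Re (f x)) xi +
    cos_transform (fun x => complex.Im (f x)) xi))%C.
Proof.
move=> lr li; have lcr := L1_cosM xi lr; have lsr := L1_sinM xi lr.
have lci := L1_cosM xi li; have lsi := L1_sinM xi li.
rewrite /fourier /cintegral; congr (_ +i* _)%C.
- rewrite -RintegralBT//; apply: eq_Rintegral => x _.
  by case: (f x) => a b.
- rewrite -RintegralDT//; apply: eq_Rintegral => x _.
  by case: (f x) => a b /=; rewrite addrC.
Qed.

Definition riesz_complex (alpha : R) f x : R[i] :=
  (riesz alpha (fun x => complex.Re (f x)) x +i*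
   riesz alpha (fun x => complex.Im (f x)) x)%C.

Variable alpha : R.
Hypotheses (alpha_gt0 : 0 < alpha) (alpha_lt2 : alpha < 2).

Lemma riesz_operator_riesz : riesz_operator alpha (riesz_complex alpha).
Proof.
move=> f [sr si].
have [cr lr Ecr Esr _] := riesz_schwartz alpha_gt0 alpha_lt2 sr.
have [ci li Eci Esi _] := riesz_schwartz alpha_gt0 alpha_lt2 si.
split => // xi.
rewrite !fourierE//; try exact: L1_schwartz.
rewrite Ecr Esr Eci Esi.
by apply/eqP; rewrite eq_complex /=; apply/andP; split; apply/eqP; ring.
Qed.

(** Real and imaginary parts of the integrand each split into the inversion
    integrand of one part of f and an odd function built from the other
    part. *)
Lemma riesz_inversion f x c : schwartz f ->
  let h xi : R[i] := cis (- (xi * x)) * ((c * `|xi| `^ alpha)%:C)%C * fourier f xi in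
  cintegrable mu h /\
  cintegral mu h = ((2 * pi * c)%:C)%C * riesz_complex alpha f x.
Proof.
move=> [sr si] h.
set fr := fun x => complex.Re (f x) in sr; set fi := fun x => complex.Im (f x) in si.
have [_ _ _ _ Ir] := riesz_schwartz alpha_gt0 alpha_lt2 sr.
have [_ _ _ _ Ii] := riesz_schwartz alpha_gt0 alpha_lt2 si.
pose wc u xi := `|xi| `^ alpha * cos_transform u xi.
pose ws u xi := `|xi| `^ alpha * sin_transform u xi.
have lwc u : real_schwartz u -> L1 mu (wc u).
  exact: (L1_powR_trig alpha_gt0 alpha_lt2 (@continuous_cos R) (@cos_max R) (@cos_addB R)).
have lws u : real_schwartz u -> L1 mu (ws u).
  exact: (L1_powR_trig alpha_gt0 alpha_lt2 (@continuous_sin R) (@sin_max R) (@sin_addB R)).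
have Lc u : L1 mu u -> L1 mu (fun xi => cos (xi * x) * u xi).
  by move=> lu; under eq_fun do rewrite [_ * x]mulrC; exact: L1_cosM.
have Ls u : L1 mu u -> L1 mu (fun xi => sin (xi * x) * u xi).
  by move=> lu; under eq_fun do rewrite [_ * x]mulrC; exact: L1_sinM.
pose even u xi := cos (xi * x) * wc u xi + sin (xi * x) * ws u xi.
pose odd_ u xi := sin (xi * x) * wc u xi - cos (xi * x) * ws u xi.
have le u : real_schwartz u -> L1 mu (even u).
  by move=> su; apply: L1D; [apply/Lc/lwc|apply/Ls/lws].
have lo u : real_schwartz u -> L1 mu (odd_ u).
  by move=> su; apply: L1B; [apply/Ls/lwc|apply/Lc/lws].
have o0 u : real_schwartz u -> \int[mu]_xi odd_ u xi = 0.
  move=> su; apply: Rintegral_odd; first exact: lo.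
  move=> xi; rewrite /odd_ /wc /ws normrN cos_transformN sin_transformN// mulNr sinN cosN.
  by ring.
have hE xi : h xi = ((c * (even fr xi + odd_ fi xi)) +i* (c * (even fi xi - odd_ fr xi)))%C.
  rewrite /h fourierE; try exact: L1_schwartz.
  rewrite /cis cosN sinN -/fr -/fi /even /odd_ /wc /ws.
  by apply/eqP; rewrite eq_complex /=; apply/andP; split; apply/eqP; ring.
have hr : (fun xi => complex.Re (h xi)) = (fun xi => c * (even fr xi + odd_ fi xi)).
  by apply/funext => xi; rewrite hE.
have hi : (fun xi => complex.Im (h xi)) = (fun xi => c * (even fi xi - odd_ fr xi)).
  by apply/funext => xi; rewrite hE.
have l1 : L1 mu (fun xi => even fr xi + odd_ fi xi) by apply: L1D; [exact: le|exact: lo].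
have l2 : L1 mu (fun xi => even fi xi - odd_ fr xi) by apply: L1B; [exact: le|exact: lo].
split.
  split.
    by have := L1Z c l1; rewrite -hr.
  by have := L1Z c l2; rewrite -hi.
rewrite /cintegral hr hi !RintegralZT//.
rewrite (RintegralDT (le _ sr) (lo _ si)) (RintegralBT (le _ si) (lo _ sr)).
rewrite !o0// Ir Ii /riesz_complex -/fr -/fi.
apply/eqP; rewrite eq_complex /=; apply/andP; split; apply/eqP;
  by move: (riesz _ _ _) (riesz _ _ _) (pi : R) => p q r; ring.
Qed.

End complex_fourier.

Section stable_generator.
Context (R : realType) (d : measure_display) (T : measurableType d) (Q : probability T R).
Variable S : R -> {RV Q >-> R}.

Lemma levy_process_rescale c : 0 <= c -> levy_process S ->
  levy_process (fun t => S (c * t)).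
Proof.
move=> c0 [S0 Sinc Sst Scont]; split.
- by rewrite mulr0.
- move=> tau tau0 ntau.
  apply: (Sinc (fun n => c * tau n)); first by rewrite mulr_ge0.
  by move=> m n mn; rewrite ler_wpM2l// ntau.
- by move=> s t B s0 t0 mB; rewrite mulrDr; apply: Sst => //; rewrite mulr_ge0.
- move=> t e t0 e0.
  apply: (@cvg_comp _ _ _ (fun s => c * s) (fun s => Q [set w | e < `|S s w - S (c * t) w|])
    _ (within [set s | 0 <= s] (nbhs (c * t)))); last by apply: Scont; rewrite ?mulr_ge0.
  have cc : c * s @[s --> t] --> c * t by apply: cvgM => //; exact: cvg_cst.
  move=> A /= /cc; rewrite /within/= !nbhs_simpl/= => h.
  apply: filterS h => s /= h s0; apply: h; exact: mulr_ge0.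
Qed.

Variable alpha : R.
Hypothesis S_stable : symmetric_stable_process alpha S.

(** The symbol is the right derivative at 0 of t |-> exp (- t c |xi|^alpha). *)
Lemma stable_fourier_symbol c : 0 <= c ->
  fourier_symbol (fun t => S (c * t)) (fun xi => ((c * `|xi| `^ alpha)%:C)%C).
Proof.
move=> c0 xi D; have [_ chi] := S_stable; set p := `|xi| `^ alpha.
have DE t : 0 <= t -> D t = ((expR (- (c * p) * t) - 1)%:C)%C.
  move=> t0; rewrite /D !chi ?mulr_ge0// mulr0 oppr0 mul0r expR0.
  rewrite (_ : - (c * t) * p = - (c * p) * t); last by ring.
  by apply/eqP; rewrite eq_complex/= subr0 !eqxx.
pose f t := expR (- (c * p) * t).
have df : is_derive (0 : R) (1 : R) f (- (c * p)).
  by apply: is_derive_eq; rewrite /GRing.scale/= mulr0 expR0; ring.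
have [ex E] := df.
have cD : t^-1 * (f t - 1) @[t --> 0^'+] --> - (c * p).
  apply: cvg_dnbhs_at_right; rewrite -E.
  have cf : t^-1 *: ((f \o shift 0) (t *: 1) - f 0) @[t --> 0^'] --> 'D_1 f 0 := ex.
  rewrite (_ : (fun t => t^-1 * (f t - 1)) =
    (fun t => t^-1 *: ((f \o shift 0) (t *: 1) - f 0))) //.
  apply/funext => t; by rewrite /= addr0 [t *: 1]mulr1 [f 0]/f mulr0 expR0.
split.
  apply: cvg_trans cD; apply: near_eq_cvg; near=> t.
  by rewrite DE//; near: t; exact: nbhs_right_ge.
rewrite oppr0; apply: cvg_near_cst; near=> t.
by rewrite DE ?mulr0//; near: t; exact: nbhs_right_ge.
Unshelve. all: by end_near. Qed.

Lemma stable_has_generator c : 0 < alpha -> alpha < 2 -> 0 <= c ->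
  has_generator (fun t => S (c * t))
    (fun f x => - ((c)%:C)%C * riesz_complex alpha f x).
Proof.
move=> a0 a2 c0; split; first by apply: levy_process_rescale => //; case: S_stable.
exists (fun xi => ((c * `|xi| `^ alpha)%:C)%C); first exact: stable_fourier_symbol.
move=> f sf x h; have [ih E] := riesz_inversion a0 a2 x c sf.
split => //; rewrite /h E mulrA; congr (_ * _).
have p0 : pi != 0 :> R by rewrite gt_eqF// pi_gt0.
apply/eqP; rewrite eq_complex /=; apply/andP; split; apply/eqP.
  by move: (pi : R) p0 => p p0; field.
by ring.
Qed.

End stable_generator.

Theorem theorem2 (R : realType) (lambda alpha : R)
  (lambda_gt0 : 0 < lambda) (alpha_gt0 : 0 < alpha) (alpha_lt2 : alpha < 2)
  (d : measure_display) (T : measurableType d) (P : probability T R)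
  (N : R -> {RV P >-> nat}) (X eps : nat -> {RV P >-> R})
  (N_poisson : poisson_process lambda N)
  (X_exp : forall (j : nat) (B : set R), measurable B ->
    distribution P (X j) B = exponential_prob alpha B)
  (eps_sign : forall j : nat,
    P [set w | eps j w = 1] = (2^-1 : R)%:E /\
    P [set w | eps j w = -1] = (2^-1 : R)%:E)
  (indep : mutually_independent P (input_sigma N X eps))
  (d' : measure_display) (T' : measurableType d') (Q : probability T' R)
  (S : R -> {RV Q >-> R}) (S_stable : symmetric_stable_process alpha S) :
  let C := stable_const alpha in
  (forall t : R, 0 < t ->
    cvg_in_distribution P Q (0 : R)^'+
      (fun gamma => jump_sum N X eps gamma (t / gamma `^ alpha))
      (S (alpha * lambda * C * t))) /\
  exists2 D : (R -> R[i]) -> R -> R[i], riesz_operator alpha D &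
    has_generator (fun t => S (alpha * lambda * C * t))
      (fun f x => - ((alpha * lambda * C)%:C)%C * D f x).
Proof.
split; first by move=> t; exact: jump_sum_cvg_in_distribution.
exists (riesz_complex alpha); first exact: riesz_operator_riesz.
apply: stable_has_generator => //.
by apply/ltW/mulr_gt0; [exact: mulr_gt0|exact: stable_const_gt0].
Qed.
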